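(* Let $(M^n,J,g)$ be a BTP (Bismut torsion parallel) Hermitian manifold of complex dimension $n\ge 2$, not necessarily compact or complete. If its Chern holomorphic sectional curvature is a nonzero constant, then $g$ is Kähler.
   Context: The metric $g$ is extended complex bilinearly to $TM\otimes_{\mathbb R}\mathbb C$, and $\|X\|^2=g(X,\overline X)$ for $X\in T^{1,0}M$. $R^c$ is the curvature of the Chern connection (with $R^c(X,\overline Y,Z,\overline W)=g(R^c(X,\overline Y)Z,\overline W)$ and $R(X,Y)=\nabla_X\nabla_Y-\nabla_Y\nabla_X-\nabla_{[X,Y]}$). For nonzero $X\in T^{1,0}M$, the Chern holomorphic sectional curvature is $H^c(X)=R^c(X,\overline X,X,\overline X)/\|X\|^4$; it is a nonzero constant if there is a constant $c\ne0$ with $H^c(X)=c$ for all nonzero $X\in T^{1,0}M$. The Bismut connection $\nabla^b$ is the unique Hermitian connection ($\nabla^b g=0$, $\nabla^b J=0$) whose torsion $T^b$ is totally skew-symmetric. $g$ is BTP if $\nabla^bT^b=0$; equivalently $\nabla^bT=0$, where $T$ is the torsion of the Chern connection. *)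

(* Defs.v *)
From HB Require Import structures.
From mathcomp Require Import all_boot all_order all_algebra.
From mathcomp Require Import all_classical all_reals all_analysis.
From mathcomp Require Import complex.
Set Implicit Arguments.
Unset Strict Implicit.
Unset Printing Implicit Defensive.
Import Order.TTheory GRing.Theory Num.Theory.
Import numFieldNormedType.Exports.
Local Open Scope classical_set_scope.
Local Open Scope ring_scope.
Local Open Scope complex_scope.

(** * Smooth maps between open subsets of normed spaces *)

Definition evec (R : realType) (m : nat) (i : 'I_m) : 'rV[R]_m := delta_mx 0 i.

(* [U] is meant to be open: all partial derivatives of order at most [k] exist
   and are continuous at every point of [U]. *)
Fixpoint Ck (R : realType) (m : nat) (V : normedModType R) (k : nat)
    (U : set 'rV[R]_m) (f : 'rV[R]_m -> V) : Prop :=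
  (forall x, U x -> {for x, continuous f}) /\
  match k with
  | 0 => True
  | k'.+1 => forall i : 'I_m,
      (forall x, U x -> derivable f x (evec R i)) /\
      Ck k' U (fun x => 'D_(evec R i) f x)
  end.

Definition smooth (R : realType) (m : nat) (V : normedModType R)
    (U : set 'rV[R]_m) (f : 'rV[R]_m -> V) : Prop :=
  forall k, Ck k U f.

(** * Complex manifolds *)

(* Only the values of [chart_map] on [chart_dom], and those of [chart_inv] on
   the image of [chart_dom], are relevant. *)
Record chart (R : realType) (M : topologicalType) (m : nat) := Chart {
  chart_dom : set M;
  chart_map : M -> 'rV[R]_m;
  chart_inv : 'rV[R]_m -> M;
  chart_dom_open : open chart_dom;
  chart_im_open : open (chart_map @` chart_dom);
  chart_mapK : forall p, chart_dom p -> chart_inv (chart_map p) = p;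
  chart_map_cont : {within chart_dom, continuous chart_map};
  chart_inv_cont : {within chart_map @` chart_dom, continuous chart_inv}
}.

Definition chart_im (R : realType) (M : topologicalType) (m : nat)
    (a : chart R M m) : set 'rV[R]_m := chart_map a @` chart_dom a.

Definition overlap (R : realType) (M : topologicalType) (m : nat)
    (a b : chart R M m) : set 'rV[R]_m :=
  chart_map a @` (chart_dom a `&` chart_dom b).

Definition transition (R : realType) (M : topologicalType) (m : nat)
    (a b : chart R M m) (x : 'rV[R]_m) : 'rV[R]_m :=
  chart_map b (chart_inv a x).

(* C^n is R^(n+n) with coordinates (x_1,...,x_n,y_1,...,y_n), z_j = x_j + i y_j.
   Tangent vectors are row vectors, J v = v *m stdJ, so that
   J(d/dx_j) = d/dy_j and J(d/dy_j) = - d/dx_j. *)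
Definition stdJ (R : realType) (n : nat) : 'M[R]_(n + n) :=
  block_mx 0 1%:M (- 1%:M) 0.

(* The Cauchy-Riemann equations [transition_holo] say that the smooth
   transition maps are holomorphic; hence J, which is [stdJ] in each chart, is
   well defined on the tangent bundle. *)
Record complexManifold (R : realType) (n : nat) := ComplexManifold {
  carrier :> topologicalType;
  carrier_hausdorff : hausdorff_space carrier;
  carrier_countable : @second_countable carrier;
  atlas : set (chart R carrier (n + n));
  atlas_cover : forall p : carrier, exists2 a, atlas a & chart_dom a p;
  transition_smooth : forall a b, atlas a -> atlas b ->
    smooth (overlap a b) (transition a b);
  transition_holo : forall a b, atlas a -> atlas b ->
    forall x, overlap a b x -> forall v : 'rV[R]_(n + n),
    'D_(v *m stdJ R n) (transition a b) x =
    'D_v (transition a b) x *m stdJ R n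
}.

(** * Tensor calculus on an open subset of R^m *)

Definition vfield (R : realType) (m : nat) := 'rV[R]_m -> 'rV[R]_m.

Definition coord_field (R : realType) (m : nat) (i : 'I_m) : vfield R m :=
  fun=> evec R i.

Definition lie_bracket (R : realType) (m : nat) (X Y : vfield R m) :
    vfield R m :=
  fun x => 'D_(X x) Y x - 'D_(Y x) X x.

Definition bilin (R : realType) (m : nat) (G : 'M[R]_m) (u v : 'rV[R]_m) : R :=
  (u *m G *m v^T) 0 0.

Definition pairing (R : realType) (m : nat) (G : 'rV[R]_m -> 'M[R]_m)
    (X Y : vfield R m) : 'rV[R]_m -> R :=
  fun x => bilin (G x) (X x) (Y x).

(* Christoffel symbols: [Gam x i j] is the coordinate vector at [x] of the
   covariant derivative of the j-th coordinate field along the i-th one. *)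
Definition christoffel (R : realType) (m : nat) :=
  'rV[R]_m -> 'I_m -> 'I_m -> 'rV[R]_m.

Definition chris (R : realType) (m : nat) (Gam : christoffel R m)
    (x u v : 'rV[R]_m) : 'rV[R]_m :=
  \sum_(i < m) \sum_(j < m) (u 0 i * v 0 j) *: Gam x i j.

Definition nabla (R : realType) (m : nat) (Gam : christoffel R m)
    (X Y : vfield R m) : vfield R m :=
  fun x => 'D_(X x) Y x + chris Gam x (X x) (Y x).

Definition torsion (R : realType) (m : nat) (Gam : christoffel R m)
    (X Y : vfield R m) : vfield R m :=
  fun x => nabla Gam X Y x - nabla Gam Y X x - lie_bracket X Y x.

Definition curvature (R : realType) (m : nat) (Gam : christoffel R m)
    (X Y Z : vfield R m) : vfield R m :=
  fun x => nabla Gam X (nabla Gam Y Z) x - nabla Gam Y (nabla Gam X Z) x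
           - nabla Gam (lie_bracket X Y) Z x.

(* (nabla_X T)(Y, Z), where T is the torsion of nabla. *)
Definition nabla_torsion (R : realType) (m : nat) (Gam : christoffel R m)
    (X Y Z : vfield R m) : vfield R m :=
  fun x => nabla Gam X (torsion Gam Y Z) x
           - torsion Gam (nabla Gam X Y) Z x
           - torsion Gam Y (nabla Gam X Z) x.

(** ** Complex (multi)linear extensions to the complexified tangent space *)

Definition cmx (R : realType) (m p : nat) (A : 'M[R]_(m, p)) : 'M[R[i]]_(m, p) :=
  map_mx (real_complex R) A.

Definition bar (R : realType) (m : nat) (X : 'rV[R[i]]_m) : 'rV[R[i]]_m :=
  map_mx (@conjc R) X.

Definition bilinC (R : realType) (m : nat) (G : 'M[R]_m) (X Y : 'rV[R[i]]_m) :
    R[i] :=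
  (X *m cmx G *m Y^T) 0 0.

Definition torsionC (R : realType) (m : nat) (Gam : christoffel R m)
    (x : 'rV[R]_m) (X Y : 'rV[R[i]]_m) : 'rV[R[i]]_m :=
  \sum_(i < m) \sum_(j < m) (X 0 i * Y 0 j) *:
    cmx (torsion Gam (@coord_field R m i) (@coord_field R m j) x).

(* R(X, Y) Z *)
Definition curvatureC (R : realType) (m : nat) (Gam : christoffel R m)
    (x : 'rV[R]_m) (X Y Z : 'rV[R[i]]_m) : 'rV[R[i]]_m :=
  \sum_(i < m) \sum_(j < m) \sum_(k < m) (X 0 i * Y 0 j * Z 0 k) *:
    cmx (curvature Gam (@coord_field R m i) (@coord_field R m j)
           (@coord_field R m k) x).

Definition T10 (R : realType) (n : nat) (X : 'rV[R[i]]_(n + n)) : Prop :=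
  X *m cmx (stdJ R n) = 'i *: X.

(** * Hermitian metrics and affine connections *)

(* The components of a tensor field, or the Christoffel symbols of an affine
   connection, in each chart of the atlas, related by the usual transformation
   laws.  A tangent vector with components [v] at [x] in the chart [a] has
   components ['D_v (transition a b) x] in the chart [b]. *)
Record hermitianMetric (R : realType) (n : nat) (M : complexManifold R n) :=
  HermitianMetric {
  metric : chart R M (n + n) -> 'rV[R]_(n + n) -> 'M[R]_(n + n);
  metric_smooth : forall a, atlas a -> smooth (chart_im a) (metric a);
  metric_sym : forall a, atlas a -> forall x, chart_im a x ->
    forall u v, bilin (metric a x) u v = bilin (metric a x) v u;
  metric_pos : forall a, atlas a -> forall x, chart_im a x ->
    forall u, u != 0 -> 0 < bilin (metric a x) u u;
  metric_J : forall a, atlas a -> forall x, chart_im a x ->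
    forall u v,
    bilin (metric a x) (u *m stdJ R n) (v *m stdJ R n) = bilin (metric a x) u v;
  metric_transition : forall a b, atlas a -> atlas b ->
    forall x, overlap a b x -> forall u v,
    bilin (metric a x) u v =
    bilin (metric b (transition a b x))
      ('D_u (transition a b) x) ('D_v (transition a b) x)
}.

Record connection (R : realType) (n : nat) (M : complexManifold R n) :=
  Connection {
  gam : chart R M (n + n) -> christoffel R (n + n);
  gam_smooth : forall a, atlas a -> forall i j,
    smooth (chart_im a) (fun x => gam a x i j);
  gam_transition : forall a b, atlas a -> atlas b ->
    forall x, overlap a b x -> forall u v,
    'D_(chris (gam a) x u v) (transition a b) x =
    'D_u (fun y => 'D_v (transition a b) y) x +
    chris (gam b) (transition a b x)
      ('D_u (transition a b) x) ('D_v (transition a b) x)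
}.

Section HermitianGeometry.
Variables (R : realType) (n : nat) (M : complexManifold R n).
Variables (g : hermitianMetric M).
Implicit Types (D : connection M) (X Y Z : vfield R (n + n)).

(* D g = 0: X g(Y, Z) = g(D_X Y, Z) + g(Y, D_X Z). *)
Definition metric_parallel D : Prop :=
  forall a, atlas a -> forall X Y Z,
  smooth (chart_im a) X -> smooth (chart_im a) Y -> smooth (chart_im a) Z ->
  forall x, chart_im a x ->
  'D_(X x) (pairing (metric g a) Y Z) x =
  pairing (metric g a) (nabla (gam D a) X Y) Z x +
  pairing (metric g a) Y (nabla (gam D a) X Z) x.

(* D J = 0: D_X (J Y) = J (D_X Y). *)
Definition J_parallel D : Prop :=
  forall a, atlas a -> forall X Y,
  smooth (chart_im a) X -> smooth (chart_im a) Y ->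
  forall x, chart_im a x ->
  nabla (gam D a) X (fun y => Y y *m stdJ R n) x =
  nabla (gam D a) X Y x *m stdJ R n.

Definition hermitian_connection D : Prop := metric_parallel D /\ J_parallel D.

(* The Chern connection is the unique Hermitian connection whose torsion has
   vanishing (1,1)-part. *)
Definition is_chern D : Prop :=
  hermitian_connection D /\
  forall a, atlas a -> forall x, chart_im a x ->
  forall X Y : 'rV[R[i]]_(n + n), T10 X -> T10 Y ->
  torsionC (gam D a) x X (bar Y) = 0.

(* g(T(X, Y), Z) is totally skew-symmetric. *)
Definition torsion_skew D : Prop :=
  forall a, atlas a -> forall X Y Z,
  smooth (chart_im a) X -> smooth (chart_im a) Y -> smooth (chart_im a) Z ->
  forall x, chart_im a x ->
  pairing (metric g a) (torsion (gam D a) X Y) Z x =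
    - pairing (metric g a) (torsion (gam D a) Y X) Z x /\
  pairing (metric g a) (torsion (gam D a) X Y) Z x =
    - pairing (metric g a) (torsion (gam D a) X Z) Y x.

Definition is_bismut D : Prop := hermitian_connection D /\ torsion_skew D.

Definition torsion_parallel D : Prop :=
  forall a, atlas a -> forall X Y Z,
  smooth (chart_im a) X -> smooth (chart_im a) Y -> smooth (chart_im a) Z ->
  forall x, chart_im a x -> nabla_torsion (gam D a) X Y Z x = 0.

(* A Bismut connection exists and is unique, so that the existential picks
   "the" Bismut connection; likewise for the Chern connection below. *)
Definition BTP : Prop := exists2 D, is_bismut D & torsion_parallel D.

(* H(X) = R(X, bar X, X, bar X) / |X|^4 with R(X, Y, Z, W) = g(R(X, Y) Z, W)
   and |X|^2 = g(X, bar X). *)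
Definition hol_sec_curv D (a : chart R M (n + n)) (x : 'rV[R]_(n + n))
    (X : 'rV[R[i]]_(n + n)) : R[i] :=
  bilinC (metric g a x) (curvatureC (gam D a) x X (bar X) X) (bar X)
  / bilinC (metric g a x) X (bar X) ^+ 2.

Definition chern_hol_sec_curv_const (c : R) : Prop :=
  exists2 D, is_chern D &
  forall a, atlas a -> forall x, chart_im a x ->
  forall X : 'rV[R[i]]_(n + n), T10 X -> X != 0 ->
  hol_sec_curv D a x X = c%:C.

(* Components of the fundamental form omega(X, Y) = g(J X, Y). *)
Definition kahler_form (a : chart R M (n + n)) (i j : 'I_(n + n))
    (x : 'rV[R]_(n + n)) : R :=
  bilin (metric g a x) (evec R i *m stdJ R n) (evec R j).

(* d omega = 0 in coordinates. *)
Definition is_kahler : Prop :=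
  forall a, atlas a -> forall x, chart_im a x ->
  forall i j k : 'I_(n + n),
  'D_(evec R i) (kahler_form a j k) x +
  'D_(evec R j) (kahler_form a k i) x +
  'D_(evec R k) (kahler_form a i j) x = 0.

End HermitianGeometry.

(* Main.v *)
Require Import Defs.
From HB Require Import structures.
From mathcomp Require Import all_boot all_order all_algebra.
From mathcomp Require Import all_classical all_reals all_analysis.
From mathcomp Require Import complex ring lra.
Set Implicit Arguments.
Unset Strict Implicit.
Unset Printing Implicit Defensive.
Import Order.TTheory GRing.Theory Num.Theory.
Local Open Scope ring_scope.

(** Fix a point, let V be its space of (1,0)-vectors, T the Bismut torsion, R
    the Bismut curvature, and g the complex bilinear extension of the metric,
    which pairs V with its conjugate V' and vanishes on V and on V'.  Since T is
    totally skew and parallel, the Ricci identity makes every R(X, Y) a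
    derivation of T, and the first Bianchi identity equates the cyclic sums of
    R(X, Y)Z and of T(T(X, Y), Z).  Hence V is a complex Lie algebra for the
    bracket [X, Y] = T(X, Y) ([br_jacobi]).

    The Chern connection differs from the Bismut connection by the part A of T
    that commutes with J ([chern_difference]).  As A is parallel too, the Chern
    curvature is R(X, Y) - A_T(X,Y) + [A_X, A_Y] ([curv_sub_parallel]), and the
    polarized curvature hypothesis becomes, for X in V and Y in V',
      g(R(X, Y)X, Y) = c g(X, Y)^2 + g(p, q),    T(X, Y) = p + q,
    with p in V and q in V' ([hol_sec_bismut]).  The rest is algebra.

    All ad_X are nilpotent ([trace_ad0], [ad_nilpotent]).  Let P be a polynomial
    in ad_X and let Y in V' represent the linear form Z |-> tr(P ad_Z) on V.
    This form vanishes on all [X, Z], which gives g(p, q) = 0, and on R(X, Y)X,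
    because R(X, Y) is a derivation.  So c g(X, Y)^2 = 0, that is
    tr(P ad_X) = 0 for every P, which forces ad_X to be nilpotent.

    By Engel's theorem ([engel]) V, unless it is zero, has a central Z != 0.
    Let Z' be the conjugate of Z and s = (2c/3) g(Z, Z').  The derivation
    D = R(Z, Z') is s modulo the center, so D = 2s on every bracket
    C = [A, B]; as 2s is not s, C is central.  But on the center D is
    (c/2)(g(Z, Z') + g(., Z') Z), whose eigenvalues 3s/4 and 3s/2 are not 2s.
    So C = 0: V is abelian ([abelian_of_central]), and T, being real and skew,
    vanishes ([torsion_eq0]).  The Bismut connection is then torsion-free with
    g and J parallel, whence d omega = 0 ([kahler_form_closed]).

    Vectors are rows and endomorphisms act on the right, so that T(X, Y) reads
    [Y *m ad X], the matrix [ad X] being that of T(X, .). *)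

(** * Nilpotent matrices and Engel's theorem *)

(** In a rank factorization [e = A *m B] of an idempotent, [B *m A] is the
    identity matrix of size the rank. *)
Lemma mxtrace_idempotent (F : fieldType) (m : nat) (e : 'M[F]_m) :
  e *m e = e -> \tr e = (\rank e)%:R.
Proof.
move=> ee.
have factor r (A : 'M[F]_(m, r)) (B : 'M[F]_(r, m)) (C : 'M[F]_(r, m)) D :
    A *m B = e -> C *m A = 1%:M -> B *m D = 1%:M -> \tr e = r%:R.
  move=> eB hC hD.
  suff BA : B *m A = 1%:M by rewrite -eB mxtrace_mulC BA mxtrace1.
  have : C *m (e *m e) *m D = C *m e *m D by rewrite ee.
  by rewrite -eB -!mulmxA hD mulmx1 !mulmxA hC mul1mx.
have/row_freeP[D hD] := row_base_free e.
have/row_fullP[C hC] := col_base_full e.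
exact: factor (mulmx_base e) hC hD.
Qed.

(** Write the characteristic polynomial as [h * 'X^r] with [h] prime to ['X].
    The Fitting projector onto the part where [A] is invertible is a multiple
    of [A] in the polynomials in [A], so its trace, which is its rank, is 0. *)
Lemma nilpotent_of_trace0 (F : fieldType) (m : nat) (A : 'M[F]_m.+1) :
  [pchar F] =i pred0 ->
  (forall p : {poly F}, \tr (horner_mx A p *m A) = 0) ->
  exists k, A ^+ k = 0.
Proof.
move=> F0 trA.
have cp0 : char_poly A != 0 by rewrite monic_neq0 ?char_poly_monic.
have [r [h]] := multiplicity_XsubC (char_poly A) 0.
rewrite cp0 subr0 /= => h0 cpE.
have cop : coprimep ('X^(r.+1)) h.
  by rewrite coprimep_expl // coprimep_sym -['X]subr0 coprimep_XsubC.
have /Bezout_eq1_coprimepP [[u v] /= uv] := cop.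
have hXA : horner_mx A (h * 'X^r) = 0 by rewrite -cpE Cayley_Hamilton.
(* The exponent is r + 1 so that the projector is divisible by A if r = 0. *)
pose e := horner_mx A (u * 'X^(r.+1)).
have fE : horner_mx A (v * h) = 1 - e.
  by rewrite /e -[1](rmorph1 (horner_mx A)) -uv rmorphD /= addrC addKr.
have ee : e *m e = e.
  apply/eqP; rewrite -subr_eq0 -opprB oppr_eq0 -{1}[e]mulmx1 -mulmxBr.
  rewrite -[1%:M]/1 -fE -[_ *m _]rmorphM.
  have -> : u * 'X^(r.+1) * (v * h) = u * v * 'X * (h * 'X^r).
    by rewrite exprS; ring.
  by rewrite rmorphM /= hXA mulr0.
have tre : \tr e = 0.
  by rewrite /e exprSr mulrA rmorphM /= horner_mx_X trA.
have e0 : e = 0.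
  apply/eqP; rewrite -mxrank_eq0.
  by move: tre; rewrite mxtrace_idempotent // => /eqP;
    rewrite ((pcharf0P F).1 F0).
exists r.
have -> : A ^+ r = horner_mx A 'X^r by rewrite rmorphXn /= horner_mx_X.
rewrite -[LHS]mulr1 -[X in _ * X]subr0 -e0 -fE -[LHS](rmorphM (horner_mx A)).
have -> : 'X^r * (v * h) = v * (h * 'X^r) by ring.
by rewrite rmorphM /= hXA mulr0.
Qed.

Section Engel.
Variables (F : fieldType) (m : nat) (ad : {linear 'rV[F]_m -> 'M[F]_m}).
Variable U : 'M[F]_m.
Local Notation "[ x , y ]" := (y *m ad x).

Hypothesis br_alt : forall x : 'rV[F]_m, [x, x] = 0.
Hypothesis br_in : forall x y : 'rV[F]_m, (x <= U)%MS -> (y <= U)%MS ->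
  ([x, y] <= U)%MS.
Hypothesis br_jacobi : forall x y z : 'rV[F]_m,
  (x <= U)%MS -> (y <= U)%MS -> (z <= U)%MS ->
  [[x, y], z] = [x, [y, z]] - [y, [x, z]].
Hypothesis ad_nilpotent : forall x v : 'rV[F]_m, (x <= U)%MS -> (v <= U)%MS ->
  exists k, iter k (fun w : 'rV[F]_m => [x, w]) v = 0.

Let br_anti (x y : 'rV[F]_m) : [x, y] = - [y, x].
Proof.
have := br_alt (x + y); rewrite linearD !mulmxDr !mulmxDl !br_alt addr0 add0r.
by move/eqP; rewrite addr_eq0 => /eqP.
Qed.

Let stable (H A : 'M[F]_m) : Prop :=
  forall h v : 'rV[F]_m, (h <= H)%MS -> (v <= A)%MS -> ([h, v] <= A)%MS.

(** [H] acts on every subquotient [B / A] with a common kernel.  Asking this of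
    all subquotients, and not only of [U], is what makes the step below work:
    it applies to [U / H] to enlarge [H], and again to the larger algebra. *)
Let triangular (H : 'M[F]_m) : Prop :=
  forall A B : 'M[F]_m, (A <= B)%MS -> (B <= U)%MS -> ~~ (B <= A)%MS ->
  stable H A -> stable H B ->
  exists v : 'rV_m, [/\ (v <= B)%MS, ~~ (v <= A)%MS &
    forall h : 'rV[F]_m, (h <= H)%MS -> ([h, v] <= A)%MS].

(** A vector [x] outside [H] that [H] maps into [H] yields the larger algebra
    [H + x].  On a subquotient the common kernel of [H] is stable under [x], and
    [x] is nilpotent there. *)
Let engel_step (H : 'M[F]_m) :
  (H <= U)%MS -> stable H H -> triangular H -> ~~ (U <= H)%MS ->
  exists H' : 'M[F]_m,
    [/\ (H' <= U)%MS, stable H' H', triangular H' & \rank H < \rank H']%N.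
Proof.
move=> HU stH trH nUH.
have stU : stable H U by move=> h v hH; apply: br_in; exact: submx_trans hH HU.
have [x [xU xH hx]] := trH _ _ HU (submx_refl _) nUH stH stU.
have xH' : (x <= (H + x)%MS)%MS by exact: addsmxSr.
have HH' : (H <= (H + x)%MS)%MS by exact: addsmxSl.
have inH' (u : 'rV_m) : (u <= (H + x)%MS)%MS ->
    exists2 h : 'rV_m, (h <= H)%MS & exists t, u = h + t *: x.
  case/sub_addsmxP => -[a b] /= ->; exists (a *m H); first exact: submxMl.
  exists (b 0 0); congr (_ + _).
  by rewrite [b in LHS]mx11_scalar mul_scalar_mx.
exists (H + x)%MS; split.
- by rewrite addsmx_sub HU.
- move=> u v /inH'[h hH [t ->]] /inH'[k kH [s ->]].
  rewrite linearD linearZ /= !mulmxDl !mulmxDr -!scalemxAl -!scalemxAr br_alt.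
  rewrite !scaler0 addr0; apply: submx_trans HH'.
  rewrite [k *m ad x]br_anti.
  by rewrite !addmx_sub ?scalemx_sub ?eqmx_opp ?hx ?stH.
- move=> A B AB BU nBA stA stB.
  have st' C : stable (H + x)%MS C -> stable H C.
    by move=> stC h v hH; apply: stC; exact: submx_trans hH HH'.
  have [v [vB vA hv]] := trH _ _ AB BU nBA (st' _ stA) (st' _ stB).
  pose f (w : 'rV[F]_m) := [x, w].
  have invK k : (iter k f v <= B)%MS /\
      forall h : 'rV[F]_m, (h <= H)%MS -> ([h, iter k f v] <= A)%MS.
    elim: k => [//|k [IB IH]]; split=> [|h hH]; first exact: stB.
    rewrite iterS; have -> : [h, f (iter k f v)]
       = [[h, x], iter k f v] + [x, [h, iter k f v]].
      by rewrite br_jacobi ?subrK // ?(submx_trans hH) ?(submx_trans IB).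
    apply: addmx_sub; [apply: IH; exact: hx|apply: stA => //; exact: IH].
  have [|k0 k0P] := ad_nilpotent (x := x) (v := v) xU.
    exact: submx_trans BU.
  have ex0 : exists k, (iter k f v <= A)%MS by exists k0; rewrite k0P sub0mx.
  (* The last iterate outside A. *)
  case: (ex_minnP ex0) => -[|k] kA kmin; first by rewrite kA in vA.
  exists (iter k f v); have [IB IH] := invK k; split => //.
    by apply/negP => /kmin; rewrite ltnn.
  move=> _ /inH'[h hH [t ->]].
  rewrite linearD linearZ /= mulmxDr -scalemxAr.
  by apply: addmx_sub; [exact: IH|apply: scalemx_sub; exact: kA].
- rewrite (ltn_leqif (mxrank_leqif_sup HH')); apply: contra xH => H'H.
  exact: submx_trans xH' H'H.
Qed.

(** Subalgebras satisfying [triangular] can be enlarged until they exhaust [U];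
    [triangular] for [U / 0] then gives a central vector. *)
Lemma engel : U != 0 ->
  exists z : 'rV_m, [/\ (z <= U)%MS, z != 0 & forall x : 'rV[F]_m,
    (x <= U)%MS -> [x, z] = 0].
Proof.
move=> U0.
have grow r : exists H : 'M[F]_m, [/\ (H <= U)%MS, stable H H, triangular H &
    (U <= H)%MS || (r <= \rank H)%N].
  elim: r => [|r [H [HU stH trH]]].
    exists 0; split; rewrite ?sub0mx ?orbT //.
      by move=> h v _ /submx0null->; rewrite mul0mx sub0mx.
    move=> A B AB BU /row_subPn[i iA] _ _; exists (row i B); split=> //.
      exact: row_sub.
    by move=> h /submx0null->; rewrite linear0 mulmx0 sub0mx.
  have [UH _|nUH /= rH] := boolP (U <= H)%MS; first by exists H; rewrite UH.
  have [H' [H'U stH' trH' lt]] := engel_step HU stH trH nUH.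
  by exists H'; split; rewrite // (leq_trans _ lt) ?orbT.
have [H [HU stH trH]] := grow m.+1.
rewrite [(m.+1 <= _)%N]leqNgt ltnS rank_leq_row orbF => UH.
have stU : stable H U by move=> h v hH; apply: br_in; exact: submx_trans hH HU.
have st0 : stable H 0 by move=> h v _ /submx0null->; rewrite mul0mx sub0mx.
have [|z [zU z0 hz]] := trH _ _ (sub0mx _ U) (submx_refl U) _ st0 stU.
  by rewrite submx0.
exists z; split=> //; first by rewrite submx0 in z0.
by move=> x xU; apply: submx0null; apply: hz; exact: submx_trans UH.
Qed.

End Engel.

(** * Bilinear forms given by matrices *)

Section Pairing.
Variables (F : comNzRingType) (m : nat) (G : 'M[F]_m).
Implicit Types X Y : 'rV[F]_m.
Definition mxform X Y : F := (X *m G *m Y^T) 0 0.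

Lemma mxformDl X X' Y : mxform (X + X') Y = mxform X Y + mxform X' Y.
Proof. by rewrite /mxform !mulmxDl mxE. Qed.
Lemma mxformDr X Y Y' : mxform X (Y + Y') = mxform X Y + mxform X Y'.
Proof. by rewrite /mxform linearD mulmxDr mxE. Qed.
Lemma mxformZl a X Y : mxform (a *: X) Y = a * mxform X Y.
Proof. by rewrite /mxform -!scalemxAl mxE. Qed.
Lemma mxformZr a X Y : mxform X (a *: Y) = a * mxform X Y.
Proof. by rewrite /mxform linearZ /= -scalemxAr mxE. Qed.
Lemma mxformNl X Y : mxform (- X) Y = - mxform X Y.
Proof. by rewrite -scaleN1r mxformZl mulN1r. Qed.
Lemma mxformNr X Y : mxform X (- Y) = - mxform X Y.
Proof. by rewrite -scaleN1r mxformZr mulN1r. Qed.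
Lemma mxform0l Y : mxform 0 Y = 0.
Proof. by rewrite -(scale0r 0) mxformZl mul0r. Qed.
Lemma mxform0r X : mxform X 0 = 0.
Proof. by rewrite -(scale0r 0) mxformZr mul0r. Qed.
Lemma mxformBl X X' Y : mxform (X - X') Y = mxform X Y - mxform X' Y.
Proof. by rewrite mxformDl mxformNl. Qed.
Lemma mxformBr X Y Y' : mxform X (Y - Y') = mxform X Y - mxform X Y'.
Proof. by rewrite mxformDr mxformNr. Qed.
Lemma mxformMl (A : 'M[F]_m) X Y :
  mxform (X *m A) Y = (X *m (A *m G) *m Y^T) 0 0.
Proof. by rewrite /mxform !mulmxA. Qed.
Lemma mxformMr (A : 'M[F]_m) X Y :
  mxform X (Y *m A) = (X *m (G *m A^T) *m Y^T) 0 0.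
Proof. by rewrite /mxform trmx_mul !mulmxA. Qed.

Lemma mxform_sym : G^T = G -> forall X Y, mxform X Y = mxform Y X.
Proof.
by move=> Gs X Y; rewrite /mxform -[LHS]mulr1 -[X in _ * X]mulr1
  -(trmxK (X *m G *m Y^T)) mxE !trmx_mul trmxK Gs !mulr1 mulmxA.
Qed.

Lemma form0P (A : 'M[F]_m) :
  (forall X Y, (X *m A *m Y^T) 0 0 = 0) -> A = 0.
Proof.
move=> A0; apply/matrixP => i j; rewrite mxE.
rewrite -[RHS](A0 (delta_mx 0 i) (delta_mx 0 j)).
by rewrite -rowE trmx_delta -colE !mxE.
Qed.
End Pairing.

Lemma linear_form_row (F : comNzRingType) (m : nat) (f : 'rV[F]_m -> F) :
  (forall a X Y, f (a *: X + Y) = a * f X + f Y) ->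
  exists w : 'rV[F]_m, forall X : 'rV_m, f X = (X *m w^T) 0 0.
Proof.
move=> f_lin.
have f0 : f 0 = 0.
  have /eqP := f_lin 1 0 0; rewrite scale1r addr0 mul1r -subr_eq0 opprD addrA.
  by rewrite subrr sub0r oppr_eq0 => /eqP.
have fD X Y : f (X + Y) = f X + f Y by rewrite -[X]scale1r f_lin scale1r mul1r.
have fZ a X : f (a *: X) = a * f X by rewrite -[_ *: _]addr0 f_lin f0 addr0.
exists (\row_i f (delta_mx 0 i)) => X.
rewrite {1}(row_sum_delta X) (big_morph f fD f0) mxE; apply: eq_bigr => i _.
by rewrite fZ !mxE.
Qed.

(** * The Lie algebra of (1,0)-vectors for a parallel skew torsion *)

Section ParallelTorsion.
Variables (F : numFieldType) (m : nat) (iota c : F) (J G : 'M[F]_m.+1).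
Local Notation E := 'rV[F]_m.+1.
Variables (ad : {linear E -> 'M[F]_m.+1}) (Rm : E -> E -> 'M[F]_m.+1).
Implicit Types X Y Z W : E.
Local Notation "[ X , Y ]" := (Y *m ad X).
Local Notation g := (mxform G).

Definition hol X : Prop := X *m J = iota *: X.
Definition ahol X : Prop := X *m J = - iota *: X.
Definition prhol : 'M[F]_m.+1 := 2^-1 *: (1%:M - iota *: J).
Definition prahol : 'M[F]_m.+1 := 2^-1 *: (1%:M + iota *: J).

Hypothesis iota2 : iota * iota = -1.
Hypothesis J2 : J *m J = - 1%:M.
Hypothesis Gsym : G^T = G.
Hypothesis Gunit : G \in unitmx.
Hypothesis GJ : J *m G *m J^T = G.

Lemma prholJ : prhol *m J = iota *: prhol.
Proof.
rewrite /prhol -scalemxAl mulmxBl mul1mx -scalemxAl J2 scalerA mulrC -scalerA.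
congr (_ *: _); rewrite scalerBr scalerA iota2 scaleN1r opprK scalerN opprK.
by rewrite addrC.
Qed.

Lemma praholJ : prahol *m J = - iota *: prahol.
Proof.
rewrite /prahol -scalemxAl mulmxDl mul1mx -scalemxAl J2 scalerA mulrC -scalerA.
congr (_ *: _); rewrite scalerDr scalerA mulNr iota2 opprK scale1r.
by rewrite scalerN scaleNr addrC.
Qed.

Lemma hol_prhol X : hol (X *m prhol).
Proof. by rewrite /hol -mulmxA prholJ scalemxAr. Qed.

Lemma ahol_prahol X : ahol (X *m prahol).
Proof. by rewrite /ahol -mulmxA praholJ scalemxAr. Qed.

Lemma prholD X : X *m prhol + X *m prahol = X.
Proof.
rewrite -mulmxDr /prhol /prahol -scalerDr addrACA addNr addr0 -mulr2n.
by rewrite -[1%:M *+ 2]scaler_nat scalerA mulVf ?pnatr_eq0 // scale1r mulmx1.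
Qed.

Lemma prhol_hol X : hol X -> X *m prhol = X.
Proof.
move=> hX; rewrite /prhol -scalemxAr mulmxBr mulmx1 -scalemxAr hX scalerA iota2.
rewrite scaleN1r opprK -mulr2n -[X *+ 2]scaler_nat scalerA.
by rewrite mulVf ?pnatr_eq0 // scale1r.
Qed.

Lemma prhol_ahol X : ahol X -> X *m prhol = 0.
Proof.
move=> hX; rewrite /prhol -scalemxAr mulmxBr mulmx1 -scalemxAr hX scalerA.
by rewrite mulrN iota2 opprK scale1r subrr scaler0.
Qed.

Lemma prahol_hol X : hol X -> X *m prahol = 0.
Proof.
by move=> hX; apply: (addrI X); rewrite -{1}(prhol_hol hX) prholD addr0.
Qed.

Lemma hol_mul (A : 'M[F]_m.+1) X : A *m J = J *m A -> hol X -> hol (X *m A).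
Proof. by rewrite /hol => AJ hX; rewrite -mulmxA AJ mulmxA hX scalemxAl. Qed.

Lemma ahol_mul (A : 'M[F]_m.+1) X : A *m J = J *m A -> ahol X -> ahol (X *m A).
Proof. by rewrite /ahol => AJ hX; rewrite -mulmxA AJ mulmxA hX scalemxAl. Qed.

Lemma holD X Y : hol X -> hol Y -> hol (X + Y).
Proof. by rewrite /hol mulmxDl scalerDr => -> ->. Qed.
Lemma aholD X Y : ahol X -> ahol Y -> ahol (X + Y).
Proof. by rewrite /ahol mulmxDl scalerDr => -> ->. Qed.
Lemma holZ a X : hol X -> hol (a *: X).
Proof. by rewrite /hol -scalemxAl scalerA mulrC -scalerA => ->. Qed.

Lemma mxformJ X Y : g (X *m J) (Y *m J) = g X Y.
Proof. by rewrite /mxform trmx_mul mulmxA -2!(mulmxA X) GJ. Qed.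

Lemma eq_opp0 (a : F) : a = - a -> a = 0.
Proof. by move/eqP; rewrite -addr_eq0 -mulr2n mulrn_eq0 => /eqP. Qed.

(** A linear equation follows from a proportional one, with ratio [k]. *)
Lemma eq_comb (k a b l r : F) : l = r -> a - b = k * (l - r) -> a = b.
Proof. by move=> ->; rewrite subrr mulr0 => /eqP; rewrite subr_eq0 => /eqP. Qed.

Lemma mxform_hol X Y : hol X -> hol Y -> g X Y = 0.
Proof.
move=> hX hY; apply: eq_opp0.
by rewrite -{1}mxformJ hX hY mxformZl mxformZr mulrA iota2 mulN1r.
Qed.

Lemma mxform_ahol X Y : ahol X -> ahol Y -> g X Y = 0.
Proof.
move=> hX hY; apply: eq_opp0.
by rewrite -{1}mxformJ hX hY mxformZl mxformZr mulrA mulrNN iota2 mulN1r.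
Qed.

Lemma mxform_prahol X Y : hol X -> g X (Y *m prahol) = g X Y.
Proof.
move=> hX; rewrite -{2}(prholD Y) mxformDr [X in _ = X + _]mxform_hol ?add0r //.
exact: hol_prhol.
Qed.

Lemma hol_eq0 X : hol X -> (forall Y, ahol Y -> g X Y = 0) -> X = 0.
Proof.
move=> hX X0; suff : X *m G = 0.
  by move=> /(congr1 (mulmx^~ (invmx G))); rewrite mulmxK // mul0mx.
apply/rowP => j; rewrite [RHS]mxE.
have : g X (delta_mx 0 j) = 0.
  by rewrite -mxform_prahol // X0 //; exact: ahol_prahol.
by rewrite /mxform trmx_delta -colE mxE.
Qed.

Hypothesis br_anti : forall X Y, [X, Y] = - [Y, X].
Hypothesis br_skew : forall X Y Z, g [X, Y] Z = - g Y [X, Z].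
Hypothesis br_hol : forall X Y, hol X -> hol Y -> hol [X, Y].
Hypothesis RmDl : forall X X' Y, Rm (X + X') Y = Rm X Y + Rm X' Y.
Hypothesis RmDr : forall X Y Y', Rm X (Y + Y') = Rm X Y + Rm X Y'.
Hypothesis Rm_anti : forall X Y, Rm X Y = - Rm Y X.
Hypothesis Rm_J : forall X Y, Rm X Y *m J = J *m Rm X Y.
Hypothesis Rm_skew : forall X Y Z W, g (Z *m Rm X Y) W = - g Z (W *m Rm X Y).
Hypothesis bianchi : forall X Y Z,
  Z *m Rm X Y + X *m Rm Y Z + Y *m Rm Z X
  = [[X, Y], Z] + [[Y, Z], X] + [[Z, X], Y].
Hypothesis Rm_der : forall X Y Z,
  ad (Z *m Rm X Y) = ad Z *m Rm X Y - Rm X Y *m ad Z.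
(* The curvature condition, for the Bismut curvature, after polarization. *)
Hypothesis hol_sec : forall X Y, hol X -> ahol Y ->
  g (X *m Rm X Y) Y = c * g X Y ^+ 2 + g ([X, Y] *m prhol) [X, Y].

(* r is the curvature, q the quadratic expression in the torsion that occurs in
   the Bianchi identity, and k its part coming from the (1,0)-component. *)
Local Notation r X Y Z W := (g (Z *m Rm X Y) W).
Local Notation q X Y Z W := (g [X, Y] [Z, W]).
Local Notation k X Y Z W := (g ([X, Y] *m prhol) [Z, W]).

(** The torsion is a 3-form, hence invariant under cyclic permutations. *)
Lemma tri_cycle X Y Z : g [X, Y] Z = g X [Y, Z].
Proof. by rewrite br_anti mxformNl br_skew opprK mxform_sym // mxform_sym. Qed.

Lemma r_hol X Y Z W : hol Z -> hol W -> r X Y Z W = 0.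
Proof. by move=> hZ hW; apply: mxform_hol => //; apply: hol_mul. Qed.

Lemma r_ahol X Y Z W : ahol Z -> ahol W -> r X Y Z W = 0.
Proof. by move=> hZ hW; apply: mxform_ahol => //; apply: ahol_mul. Qed.

Lemma r_anti X Y Z W : r X Y Z W = - r Y X Z W.
Proof. by rewrite Rm_anti mulmxN mxformNl. Qed.

Lemma r_skew X Y Z W : r X Y Z W = - r X Y W Z.
Proof. by rewrite Rm_skew mxform_sym. Qed.

Lemma q_anti X Y Z W : q X Y Z W = - q Y X Z W.
Proof. by rewrite br_anti mxformNl. Qed.

Lemma q_skew X Y Z W : q X Y Z W = - q X Y W Z.
Proof. by rewrite [in LHS](br_anti Z) mxformNr. Qed.

Lemma q_sym X Y Z W : q X Y Z W = q Z W X Y.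
Proof. exact: mxform_sym. Qed.

(** [q] appears because g(T(T(X, Y), Z), W) = g(T(X, Y), T(Z, W)). *)
Lemma bianchi_form X Y Z W :
  r X Y Z W + r Y Z X W + r Z X Y W = q X Y Z W + q Y Z X W + q Z X Y W.
Proof. by rewrite -!mxformDl bianchi !mxformDl !tri_cycle. Qed.

(** Let [s] be the Jacobi cyclic sum of three (1,0)-vectors against a
    (0,1)-vector [W].  The Bianchi identity for two of them and [W] has only one
    curvature term that is not zero by type, and gives [r A B C W = s A B C];
    the one for all three then reads [3 s = s]. *)
Lemma br_jacobi X Y Z : hol X -> hol Y -> hol Z ->
  [[X, Y], Z] = [X, [Y, Z]] - [Y, [X, Z]].
Proof.
move=> hX hY hZ.
have jac W : ahol W -> q X Y Z W + q Y Z X W + q Z X Y W = 0.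
  move=> hW.
  pose s A B C := q A B C W + q B C A W + q C A B W.
  have rs A B C : hol A -> hol B -> hol C -> r A B C W = s A B C.
    move=> hA hB hC; have := bianchi_form A B W C.
    rewrite (r_hol _ _ hA hC) (r_hol _ _ hB hC) r_skew.
    rewrite (q_skew A B W) (q_sym B W) (q_anti W A) (q_sym A W).
    rewrite (q_anti A C) => e.
    by apply: (eq_comb (k := -1) e); rewrite /s; ring.
  have := bianchi_form X Y Z W; rewrite !rs // /s => e.
  apply: eq_opp0; apply: (eq_comb (k := 1) e); ring.
have -> : [X, [Y, Z]] - [Y, [X, Z]] = - [[Y, Z], X] - [[Z, X], Y].
  rewrite [in RHS](br_anti Z X) linearN mulmxN opprK.
  by rewrite (br_anti X [Y, Z]) (br_anti Y [X, Z]) opprK.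
apply/eqP; rewrite -subr_eq0 opprD !opprK addrA; apply/eqP/hol_eq0.
  by do 2?apply: holD; do 2!apply: br_hol => //.
by move=> W /jac <-; rewrite !mxformDl !tri_cycle.
Qed.

(** Full polarization of [hol_sec] in both pairs of arguments. *)
Lemma polar X A Y W : hol X -> hol A -> ahol Y -> ahol W ->
  r X Y A W + r X W A Y + r A Y X W + r A W X Y =
  c * (g X Y * g A W + g X W * g A Y) *+ 2
  + (k X Y A W + k X W A Y + k A Y X W + k A W X Y).
Proof.
move=> hX hA hY hW.
have hXA := holD hX hA; have hYW := aholD hY hW.
have e1 := hol_sec hXA hYW.
have e2 := hol_sec hXA hY; have e3 := hol_sec hXA hW.
have e4 := hol_sec hX hYW; have e5 := hol_sec hA hYW.
have e6 := hol_sec hX hY; have e7 := hol_sec hX hW.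
have e8 := hol_sec hA hY; have e9 := hol_sec hA hW.
have : r (X + A) (Y + W) (X + A) (Y + W) - r (X + A) Y (X + A) Y
   - r (X + A) W (X + A) W - r X (Y + W) X (Y + W) - r A (Y + W) A (Y + W)
   + r X Y X Y + r X W X W + r A Y A Y + r A W A W =
   (r X Y A W + r X W A Y + r A Y X W + r A W X Y).
  rewrite !(RmDl, RmDr, mulmxDl, mulmxDr, mxformDl, mxformDr).
  ring.
move=> <-; rewrite e1 e2 e3 e4 e5 e6 e7 e8 e9.
rewrite !(linearD, mulmxDl, mulmxDr, mxformDl, mxformDr).
ring.
Qed.

Lemma br_alt X : [X, X] = 0.
Proof.
apply/matrixP => i j; rewrite [RHS]mxE; apply: eq_opp0.
by rewrite {1}br_anti mxE.
Qed.

Lemma row_ext (A B : 'M[F]_m.+1) : (forall X, X *m A = X *m B) -> A = B.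
Proof. by move=> AB; apply/row_matrixP => i; rewrite !rowE. Qed.

Lemma br_prhol X Y : hol X -> [X, Y *m prhol] *m prhol = [X, Y *m prhol].
Proof. by move=> hX; apply/prhol_hol/br_hol => //; exact: hol_prhol. Qed.

(** [prhol *m ad X] is the endomorphism of the Lie algebra, extended by 0 to
    the (0,1)-vectors, so that traces may be taken on the whole space. *)
Lemma ad_br X Y : hol X -> hol Y -> prhol *m ad [X, Y] =
  (prhol *m ad Y) *m (prhol *m ad X) - (prhol *m ad X) *m (prhol *m ad Y).
Proof.
move=> hX hY; apply: row_ext => v; rewrite mulmxBr !mulmxA.
by rewrite br_jacobi ?br_prhol //; exact: hol_prhol.
Qed.

Lemma Rm_prhol X Y : Rm X Y *m prhol = prhol *m Rm X Y.
Proof.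
by rewrite /prhol -scalemxAl -scalemxAr mulmxBl mulmxBr mulmx1 mul1mx
  -scalemxAl -scalemxAr Rm_J.
Qed.

Hypothesis c0 : c != 0.

(** The linear form [phi Z = tr (P ad_Z)], with [P] a polynomial in [ad X],
    kills [[X, Z]] because [P] commutes with [ad X], and kills the image of [X]
    under a derivation for the same reason.  The vector [Y] representing [phi]
    therefore makes both [r X Y X Y] and the quadratic term of [hol_sec] vanish,
    which leaves [c * phi X ^+ 2 = 0]. *)
Lemma trace_ad0 X (p : {poly F}) : hol X ->
  \tr (horner_mx (prhol *m ad X) p *m (prhol *m ad X)) = 0.
Proof.
move=> hX; set A := prhol *m ad X; set P := horner_mx A p.
have PA : P *m A = A *m P by exact: comm_horner_mx.
pose phi Z := \tr (P *m (prhol *m ad Z)).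
have phi_lin a Z Z' : phi (a *: Z + Z') = a * phi Z + phi Z'.
  by rewrite /phi linearP /= !mulmxDr -!scalemxAr linearP.
have [w phiE] := linear_form_row phi_lin.
pose Y := (invmx G *m w^T)^T *m prahol.
have hY : ahol Y by exact: ahol_prahol.
have gY Z : hol Z -> g Z Y = phi Z.
  move=> hZ; rewrite mxform_prahol // phiE /mxform trmxK.
  by rewrite !mulmxA mulmxK.
have comm_tr B : \tr (P *m (B *m A - A *m B)) = 0.
  rewrite mulmxBr raddfB /= [P *m (B *m A)]mulmxA mxtrace_mulC.
  by rewrite [A *m (P *m B)]mulmxA [P *m (A *m B)]mulmxA PA subrr.
have phi_br Z : hol Z -> phi [X, Z] = 0.
  by move=> hZ; rewrite /phi ad_br // comm_tr.
have phiR : phi (X *m Rm X Y) = 0.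
  have AR : prhol *m (ad X *m Rm X Y - Rm X Y *m ad X)
      = - (Rm X Y *m A - A *m Rm X Y).
    by rewrite opprB mulmxBr /A !mulmxA Rm_prhol.
  by rewrite /phi Rm_der AR mulmxN raddfN /= comm_tr oppr0.
have k0 : g ([X, Y] *m prhol) [X, Y] = 0.
  have hp : hol ([X, Y] *m prhol) by exact: hol_prhol.
  rewrite -[LHS]opprK -br_skew gY ?phi_br ?oppr0 //; exact: br_hol.
have := hol_sec hX hY; rewrite k0 addr0 gY; last exact: hol_mul.
rewrite phiR gY // => /esym/eqP; rewrite mulf_eq0 (negPf c0) /= expf_eq0 /=.
by move/eqP.
Qed.

Lemma ad_nilpotent X v : hol X -> hol v ->
  exists k, iter k (fun w : E => [X, w]) v = 0.
Proof.
move=> hX hv.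
have [k Ak] := nilpotent_of_trace0 (pchar_num F) (fun p => trace_ad0 p hX).
exists k; suff <- : v *m (prhol *m ad X) ^+ k = iter k (fun w : E => [X, w]) v.
  by rewrite Ak mulmx0.
elim: k {Ak} => [|k IH]; first by rewrite expr0 mulmx1.
rewrite exprSr mulmxA IH iterS mulmxA prhol_hol // -IH.
elim: k {IH} => [|k IH]; first by rewrite expr0 mulmx1.
by rewrite exprSr !mulmxA prhol_hol //; apply: br_hol.
Qed.

Lemma hol_sub X : reflect (hol X) (X <= prhol)%MS.
Proof.
apply: (iffP submxP) => [[D ->]|hX]; first exact: hol_prhol.
by exists X; rewrite prhol_hol.
Qed.

Lemma exists_central : prhol != 0 ->
  exists Z, [/\ hol Z, Z != 0 & forall X, hol X -> [X, Z] = 0].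
Proof.
move=> pr0.
have [|||z [/hol_sub hz z0 zc]] := engel (ad := ad) br_alt _ _ _ pr0.
- by move=> x y /hol_sub hx /hol_sub hy; apply/hol_sub/br_hol.
- by move=> x y z /hol_sub hx /hol_sub hy /hol_sub hz; exact: br_jacobi.
- by move=> x v /hol_sub hx /hol_sub hv; exact: ad_nilpotent.
by exists z; split=> // X /hol_sub; exact: zc.
Qed.

Definition central Z : Prop := hol Z /\ forall X, hol X -> [X, Z] = 0.

Lemma central_orthogonal Z X Y : central Z -> hol X -> g Z [X, Y] = 0.
Proof.
by move=> [hZ Zc] hX; rewrite -[LHS]opprK -br_skew Zc // mxform0l oppr0.
Qed.

(** With [central_orthogonal]: the (0,1)-components of the vectors [[X, Y]] span
    the annihilator of the center. *)
Lemma centralP Z : hol Z -> (forall X Y, hol X -> g Z [X, Y] = 0) -> central Z.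
Proof.
move=> hZ ZO; split=> // X hX; apply: hol_eq0; first exact: br_hol.
by move=> W _; rewrite br_skew ZO ?oppr0.
Qed.

(* In this section [Z] is central and [Y] plays the part of its conjugate. *)
Section Central.
Variables Z Y : E.
Hypothesis Zc : central Z.
Hypothesis hY : ahol Y.
Hypothesis gZY : g Z Y != 0.
Hypothesis prY : forall X, hol X -> [X, Y] *m prhol = 0.

Let hZ : hol Z. Proof. by case: Zc. Qed.

Let central_br A : hol A -> [Z, A] = 0.
Proof. by case: Zc => _ Zc' hA; rewrite br_anti Zc' ?oppr0. Qed.

Let g_brZ A W : hol A -> g A [Z, W] = 0.
Proof.
by move=> hA; rewrite -[LHS]opprK -br_skew central_br // mxform0l oppr0.
Qed.

Let g_brZY X : g X [Z, Y] = 0.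
Proof.
rewrite -(prholD X) mxformDl g_brZ ?add0r; last exact: hol_prhol.
rewrite -(prholD [Z, Y]) prY // add0r.
by apply: mxform_ahol; exact: ahol_prahol.
Qed.

Let qZ A W : hol A -> q A Y Z W = k Z W A Y.
Proof.
move=> hA; rewrite q_sym -{1}(prholD [Z, W]) mxformDl addrC.
rewrite -{1}(prholD [A, Y]) prY // add0r mxform_ahol ?add0r //;
  exact: ahol_prahol.
Qed.

(** By [polar] the sum of the four curvature terms in which [Z] and [A] occupy
    the (1,0)-slots is known, and three Bianchi identities compare these terms
    with each other.  Most quadratic terms vanish since [Z] is central. *)
Lemma curvature_central A W : hol A -> ahol W ->
  r Z Y A W = c / 2 * (g Z Y * g A W + g Z W * g A Y) - 4^-1 * k Z W A Y /\
  r A Y Z W = c / 2 * (g Z Y * g A W + g Z W * g A Y) + 3 / 4 * k Z W A Y.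
Proof.
move=> hA hW.
have ZA := central_br hA; have AZ : [A, Z] = 0 by rewrite br_anti ZA oppr0.
have := polar hZ hA hY hW.
rewrite !prY // (g_brZY (_ *m _)) !mxform0l !addr0 add0r => pol.
have e1 := bianchi_form A Y Z W.
rewrite (r_anti Y Z) (r_ahol Z A hY hW) (q_anti Y Z) (q_sym Z Y) g_brZY in e1.
rewrite ZA mxform0l qZ // oppr0 !addr0 in e1.
have e2 := bianchi_form A W Z Y.
rewrite (r_anti W Z) (r_ahol Z A hW hY) g_brZY (q_anti W Z) (q_sym Z W) in e2.
rewrite ZA mxform0l qZ // !addr0 in e2.
have e3 := bianchi_form A Y W Z.
rewrite (r_skew A Y W) (r_hol Y W hA hZ) (r_anti W A) (r_skew A W) opprK in e3.
rewrite (q_skew A Y W) qZ // AZ mxform0r (q_skew W A) g_brZY in e3.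
have {}e1 : r Z Y A W = r A Y Z W - k Z W A Y.
  apply: (eq_comb (k := -1) e1); ring.
have {}e3 : r A W Z Y = r A Y Z W - k Z W A Y.
  apply: (eq_comb (k := 1) e3); ring.
have {}e2 : r Z W A Y = r A Y Z W.
  rewrite e3 in e2; apply: (eq_comb (k := -1) e2); ring.
rewrite e1 e2 e3 in pol.
have r2 : r A Y Z W =
    c / 2 * (g Z Y * g A W + g Z W * g A Y) + 3 / 4 * k Z W A Y.
  by apply: (eq_comb (k := 4^-1) pol); field.
by split=> //; rewrite e1 r2; field.
Qed.

(* The eigenvalue of [Rm Z Y] modulo the center. *)
Let s := 2 / 3 * c * g Z Y.

(** Derivations preserve the center, so [r A Y Z W = 0] when [W] annihilates it.
    By [curvature_central] this determines the quadratic term [k Z W A Y], and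
    with it [r Z Y A W]. *)
Let annihilator_eigen A W : hol A -> ahol W ->
  (forall X, central X -> g X W = 0) -> r Z Y A W = s * g A W.
Proof.
move=> hA hW Wc.
have [r1 r2] := curvature_central hA hW.
have ZRc : central (Z *m Rm A Y).
  split=> [|X hX]; first exact: hol_mul.
  rewrite (br_anti X) Rm_der mulmxBr !mulmxA !central_br //;
    last exact: hol_mul.
  by rewrite mul0mx subr0 oppr0.
rewrite r1 (Wc _ Zc) /s; rewrite (Wc _ ZRc) (Wc _ Zc) in r2.
by apply: (eq_comb (k := 3^-1) r2); field.
Qed.

(** The derivation [D = Rm Z Y] is [s] modulo the center, hence [2 s] on
    brackets, which are therefore central.  On the center the quadratic term of
    [curvature_central] vanishes and [D] does not have the eigenvalue [2 s]. *)
Lemma abelian_of_central A B : hol A -> hol B -> [A, B] = 0.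
Proof.
move=> hA hB.
have s0 : s != 0 by rewrite /s !mulf_neq0 ?invr_eq0 ?pnatr_eq0.
set D := Rm Z Y.
have hD X : hol X -> hol (X *m D) by exact: (hol_mul (Rm_J Z Y)).
have Ds X : hol X -> central (X *m D - s *: X).
  move=> hX; apply: centralP => [|V W hV].
    by apply: holD; [exact: hD|rewrite -scaleNr; exact: holZ].
  rewrite -mxform_prahol; last first.
    by apply: holD; [exact: hD|rewrite -scaleNr; exact: holZ].
  rewrite mxformBl mxformZl annihilator_eigen ?subrr //;
    first exact: ahol_prahol.
  by move=> U Uc; rewrite mxform_prahol ?central_orthogonal //; case: Uc.
have hC : hol [A, B] by exact: br_hol.
have CD : [A, B] *m D = (2 * s) *: [A, B].
  have [_ uA] := Ds _ hA; have [_ uB] := Ds _ hB.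
  have eA : [A *m D, B] = s *: [A, B].
    have : [A *m D - s *: A, B] = 0 by rewrite br_anti uA ?oppr0.
    rewrite linearB linearZ /= mulmxBr -scalemxAr => /eqP.
    by rewrite subr_eq0 => /eqP.
  have eB : [A, B *m D] = s *: [A, B].
    by apply/eqP; rewrite -subr_eq0 [_ *: _]scalemxAl -mulmxBl uB.
  move: eA; rewrite Rm_der mulmxBr !mulmxA eB => /eqP;
    rewrite subr_eq -scalerDl.
  by move/eqP->; rewrite mulr_natl.
have Cc : central [A, B].
  have := Ds _ hC; rewrite CD -scalerBl mulr_natl mulr2n addrK => -[_ sC].
  split=> // X hX; move: (sC _ hX); rewrite -scalemxAl => /eqP.
  by rewrite scaler_eq0 (negPf s0) => /eqP.
have CX X : hol X -> [[A, B], X] = 0.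
  by move=> hX; rewrite br_anti Cc.2 ?oppr0.
have eig W : ahol W -> 2 * s * g [A, B] W =
    c / 2 * (g Z Y * g [A, B] W + g Z W * g [A, B] Y).
  move=> hW; have [r1 _] := curvature_central hC hW.
  have k0 : k Z W [A, B] Y = 0.
    rewrite -[LHS]opprK -br_skew CX ?mxform0l ?oppr0 //; exact: hol_prhol.
  by move: r1; rewrite CD mxformZl k0 mulr0 subr0.
have z0 : c * g Z Y != 0 by rewrite mulf_neq0.
have CY : g [A, B] Y = 0.
  apply/eqP; rewrite -(mulrI_eq0 _ (mulfI z0)); apply/eqP.
  by apply: (eq_comb (k := 3) (eig _ hY)); rewrite /s; field.
apply: hol_eq0 => // W hW.
apply/eqP; rewrite -(mulrI_eq0 _ (mulfI z0)); apply/eqP.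
have := eig _ hW; rewrite CY mulr0 addr0 => e.
by apply: (eq_comb (k := 6 / 5) e); rewrite /s; field.
Qed.

End Central.

(* Satisfied by the complex conjugate of [Z]. *)
Hypothesis dual_vector : forall Z, hol Z -> Z != 0 ->
  exists2 Y, ahol Y & g Z Y != 0 /\
    ((forall X, hol X -> [X, Z] = 0) -> forall X, hol X -> [X, Y] *m prhol = 0).

Theorem hol_abelian A B : hol A -> hol B -> [A, B] = 0.
Proof.
move=> hA hB; have [pr0|pr0] := eqVneq prhol 0.
  by rewrite -(prhol_hol hB) pr0 mulmx0 mul0mx.
have [Z [hZ Z0 Zc]] := exists_central pr0.
have [Y hY [gZY prY]] := dual_vector hZ Z0.
exact: (abelian_of_central (Z := Z) (Y := Y) _ hY gZY (prY Zc)).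
Qed.

End ParallelTorsion.

(** * The Chern and Bismut connections at a point *)

(** The part of [A] commuting with [J], when [J] is a complex structure. *)
Definition Jpart (F : numFieldType) (m : nat) (J A : 'M[F]_m) : 'M[F]_m :=
  2^-1 *: (A - J *m A *m J).

Lemma Jpart_hol (F : numFieldType) (m : nat) (J A : 'M[F]_m.+1) iota v :
  iota * iota = -1 -> hol iota J v -> v *m Jpart J A = v *m A *m prhol iota J.
Proof.
move=> iota2 hv; rewrite /Jpart /prhol -!scalemxAr; congr (_ *: _).
by rewrite !mulmxBr !mulmxA hv mulmx1 -!scalemxAl -scalemxAr.
Qed.

Lemma JpartD (F : numFieldType) (m : nat) (J A B : 'M[F]_m) :
  Jpart J (A + B) = Jpart J A + Jpart J B.
Proof. by rewrite /Jpart mulmxDr mulmxDl -scalerDr opprD addrACA. Qed.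

(* [B] is the difference of the Bismut and the Chern connections, and [mixed]
   below says that the Chern torsion has no (1,1)-part. *)
Section ChernUniqueness.
Variables (F : numFieldType) (m : nat) (J G : 'M[F]_m.+1).
Local Notation E := 'rV[F]_m.+1.
Local Notation g := (mxform G).
Variables (ad B : {linear E -> 'M[F]_m.+1}).
Local Notation "[ X , Y ]" := (Y *m ad X).
Hypothesis J2 : J *m J = - 1%:M.
Hypothesis Gsym : G^T = G.
Hypothesis Gunit : G \in unitmx.
Hypothesis GJ : J *m G *m J^T = G.
Hypothesis br_anti : forall X Y : E, [X, Y] = - [Y, X].
Hypothesis br_skew : forall X Y Z : E, g [X, Y] Z = - g Y [X, Z].
Hypothesis BJ : forall X, B X *m J = J *m B X.
Hypothesis B_skew : forall X Z W, g (Z *m B X) W = - g Z (W *m B X).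

Lemma prahol_ahol iota (X : E) : iota * iota = -1 -> ahol iota J X ->
  X *m prahol iota J = X.
Proof. by move=> i2 hX; rewrite -{2}(prholD iota J X) prhol_ahol // add0r. Qed.

Lemma prahol_opp iota : prahol iota J = prhol (- iota) J.
Proof. by rewrite /prahol /prhol scaleNr opprK. Qed.

(** For [X] of type (1,0) and [Y] of type (0,1) the two terms on the right of
    the hypothesis have different types, so the torsion determines [B X] on
    (0,1)-vectors; skewness of [B X] then determines it on (1,0)-vectors. *)
Lemma chern_difference_hol iota : iota * iota = -1 ->
  (forall X Y : E, hol iota J X -> ahol iota J Y ->
    [X, Y] = Y *m B X - X *m B Y) ->
  forall X, hol iota J X -> B X = Jpart J (ad X).
Proof.
move=> i2 mixed X hX.
have BA Y : ahol iota J Y -> Y *m B X = Y *m Jpart J (ad X).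
  move=> hY; have i2' : - iota * - iota = -1 by rewrite mulrNN.
  rewrite (Jpart_hol (ad X) i2') // -prahol_opp (mixed _ _ hX hY) mulmxBl.
  rewrite prahol_ahol ?prahol_hol ?subr0 //; first exact: hol_mul (BJ Y) hX.
  exact: ahol_mul (BJ X) hY.
apply: row_ext => v; rewrite -(prholD iota J v) !mulmxDl; congr (_ + _);
  last first.
  by apply: BA; exact: ahol_prahol.
set Z := v *m _; have hZ : hol iota J Z by exact: hol_prhol.
have hZB : hol iota J (Z *m B X) by exact: hol_mul (BJ X) hZ.
apply/eqP; rewrite -subr_eq0; apply/eqP.
apply: (hol_eq0 i2 J2 Gunit GJ).
  rewrite (Jpart_hol (ad X) i2) //; apply: holD => //.
  by rewrite -mulNmx; exact: hol_prhol.
move=> Y hY; rewrite mxformBl (Jpart_hol (ad X) i2) // B_skew BA //.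
have i2' : - iota * - iota = -1 by rewrite mulrNN.
rewrite (Jpart_hol (ad X) i2') // -prahol_opp (mxform_prahol i2 J2 GJ) //.
rewrite -br_skew.
rewrite -{1}(prholD iota J [X, Z]) mxformDl [X in _ + X - _](mxform_ahol i2 GJ)
  //.
  by rewrite addr0 subrr.
exact: ahol_prahol.
Qed.

Lemma chern_difference iota : iota * iota = -1 ->
  (forall X Y : E, hol iota J X -> ahol iota J Y ->
    [X, Y] = Y *m B X - X *m B Y) ->
  forall X, B X = Jpart J (ad X).
Proof.
move=> i2 mixed X; have i2' : - iota * - iota = -1 by rewrite mulrNN.
rewrite -(prholD iota J X) !linearD JpartD; congr (_ + _).
  apply: (chern_difference_hol i2 mixed); exact: hol_prhol.
apply: (chern_difference_hol i2'); last by rewrite prahol_opp; exact: hol_prhol.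
move=> Y Z hY; rewrite /ahol opprK => hZ.
by rewrite br_anti (mixed _ _ hZ hY) opprB.
Qed.

End ChernUniqueness.

(** A polynomial in [a] and its conjugate, of bidegree at most (2, 2), that
    vanishes identically has no term in the square of the conjugate.  Averaging
    over the fourth roots of unity isolates the combination [p02 + p20], and the
    same average scaled by [1 + iota], whose square is [2 * iota], isolates
    [p02 - p20]. *)
Lemma bidegree_coef (F : numFieldType) (conj : {rmorphism F -> F}) (iota : F)
    (p00 p01 p02 p10 p11 p12 p20 p21 p22 : F) :
  iota * iota = -1 -> conj iota = - iota ->
  (forall a, let b := conj a in
    p00 + b * p01 + b * b * p02 + a * (p10 + b * p11 + b * b * p12)
    + a * a * (p20 + b * p21 + b * b * p22) = 0) -> p02 = 0.
Proof.
move=> i2 ci /= P0.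
pose h a b := p00 + b * p01 + b * b * p02 + a * (p10 + b * p11 + b * b * p12)
  + a * a * (p20 + b * p21 + b * b * p22).
have h0 a b : conj a = b -> h a b = 0 by move=> <-; exact: P0.
have : 16 * p02 =
  2 * (h 1 1 + h (- 1) (- 1) - h iota (- iota) - h (- iota) iota)
  + iota * (h (1 + iota) (1 - iota) + h (- (1 + iota)) (- (1 - iota))
    - h (iota * (1 + iota)) (- iota * (1 - iota))
    - h (- (iota * (1 + iota))) (iota * (1 - iota))).
  rewrite /h; ring: i2.
rewrite !h0 ?(rmorphM, rmorphN, rmorphD, rmorph1, ci, opprK, mulNr) //.
rewrite !addr0 !subr0 !mulr0 addr0 => /eqP.
by rewrite mulf_eq0 pnatr_eq0 => /eqP.
Qed.

(* [Rm] is the curvature of the Bismut connection, [Rc] of the Chern one. *)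
Section HermitianTorsion.
Variables (F : numFieldType) (conj : {rmorphism F -> F}) (m : nat).
Variables (iota c : F) (J G : 'M[F]_m.+1).
Local Notation E := 'rV[F]_m.+1.
Local Notation g := (mxform G).
Variables (ad : {linear E -> 'M[F]_m.+1}) (Rm Rc : E -> E -> 'M[F]_m.+1).
Implicit Types X Y Z W : E.
Local Notation "[ X , Y ]" := (Y *m ad X).
Local Notation bar := (map_mx conj).
Local Notation hol := (hol iota J).
Local Notation ahol := (ahol iota J).
Local Notation prhol := (prhol iota J).
Local Notation prahol := (prahol iota J).
Local Notation A X := (Jpart J (ad X)).

Hypothesis conjK : involutive conj.
Hypothesis conj_iota : conj iota = - iota.
Hypothesis iota2 : iota * iota = -1.
Hypothesis J2 : J *m J = - 1%:M.
Hypothesis Gsym : G^T = G.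
Hypothesis GJ : J *m G *m J^T = G.
Hypothesis G_pos : forall X : E, X != 0 -> g X (bar X) != 0.
Hypothesis barJ : bar J = J.
Hypothesis br_bar : forall X Y, [bar X, bar Y] = bar [X, Y].
Hypothesis br_anti : forall X Y, [X, Y] = - [Y, X].
Hypothesis br_skew : forall X Y Z, g [X, Y] Z = - g Y [X, Z].
Hypothesis br_hol : forall X Y, hol X -> hol Y -> hol [X, Y].
Hypothesis RmDl : forall X X' Y, Rm (X + X') Y = Rm X Y + Rm X' Y.
Hypothesis RmDr : forall X Y Y', Rm X (Y + Y') = Rm X Y + Rm X Y'.
Hypothesis Rm_anti : forall X Y, Rm X Y = - Rm Y X.
Hypothesis Rm_J : forall X Y, Rm X Y *m J = J *m Rm X Y.
Hypothesis Rm_skew : forall X Y Z W, g (Z *m Rm X Y) W = - g Z (W *m Rm X Y).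
Hypothesis bianchi : forall X Y Z,
  Z *m Rm X Y + X *m Rm Y Z + Y *m Rm Z X
  = [[X, Y], Z] + [[Y, Z], X] + [[Z, X], Y].
Hypothesis Rm_der : forall X Y Z,
  ad (Z *m Rm X Y) = ad Z *m Rm X Y - Rm X Y *m ad Z.
Hypothesis RcPl : forall a X X' Y, Rc (a *: X + X') Y = a *: Rc X Y + Rc X' Y.
Hypothesis RcPr : forall a X Y Y', Rc X (a *: Y + Y') = a *: Rc X Y + Rc X Y'.
Hypothesis Rc_Rm : forall X Y,
  Rc X Y = Rm X Y - A [X, Y] + A Y *m A X - A X *m A Y.
Hypothesis Rc_sec : forall X, hol X ->
  g (X *m Rc X (bar X)) (bar X) = c * g X (bar X) ^+ 2.
Hypothesis c0 : c != 0.

Let barK X : bar (bar X) = X.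
Proof. by apply/matrixP => i j; rewrite !mxE conjK. Qed.

Lemma bar_hol X : hol X -> ahol (bar X).
Proof.
by rewrite /hol /ahol => /(congr1 bar); rewrite map_mxM barJ map_mxZ /=
  conj_iota.
Qed.

Lemma bar_ahol X : ahol X -> hol (bar X).
Proof.
rewrite /hol /ahol => /(congr1 bar).
by rewrite map_mxM barJ map_mxZ /= rmorphN /= conj_iota opprK.
Qed.

Lemma mxform_unit : G \in unitmx.
Proof.
rewrite -row_free_unit -kermx_eq0; apply/eqP/row_matrixP => i; rewrite row0.
set X := row i (kermx G); apply/eqP; apply/negP => /negP/G_pos/eqP; apply.
have /sub_kermxP XG : (X <= kermx G)%MS by exact: row_sub.
by rewrite /mxform XG mul0mx mxE.
Qed.
Let Gu := mxform_unit.

(** The hypothesis at [X + a *: bar Y] is a polynomial identity in [a] and its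
    conjugate; the sought equation is its coefficient of bidegree (0, 2). *)
Lemma Rc_polar X Y : hol X -> ahol Y -> g (X *m Rc X Y) Y = c * g X Y ^+ 2.
Proof.
move=> hX hY; have hY' := bar_ahol hY.
pose h (U V U' V' : E) := g (V *m Rc U U') V' - c * (g U U' * g V V').
set V := bar Y in hY'; set X' := bar X.
suff : h X X Y Y = 0.
  by move/eqP; rewrite /h subr_eq0 expr2 => /eqP.
apply: (bidegree_coef (p00 := h X X X' X') (p01 := h X X Y X' + h X X X' Y)
  (p10 := h V X X' X' + h X V X' X') (p20 := h V V X' X')
  (p11 := h V X Y X' + h V X X' Y + h X V Y X' + h X V X' Y)
  (p12 := h V X Y Y + h X V Y Y) (p21 := h V V Y X' + h V V X' Y)
  (p22 := h V V Y Y) iota2 conj_iota) => a b.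
have := Rc_sec (holD hX (holZ a hY')).
have -> : bar (X + a *: V) = b *: Y + X'.
  by rewrite map_mxD map_mxZ /= addrC /V barK.
have -> : X + a *: V = a *: V + X by rewrite addrC.
rewrite RcPl !RcPr.
rewrite !(mulmxDl, mulmxDr, scalerDr, mxformDl, mxformDr, mxformZl, mxformZr).
rewrite -!(scalemxAl, scalemxAr) !(mxformDl, mxformDr, mxformZl, mxformZr).
move/eqP; rewrite -subr_eq0 => /eqP <-.
rewrite /h; ring.
Qed.

(** In [Rc_Rm] the term [A [X, Y]] contributes [g [X, Y] [X, Y]], which is twice
    g(p, q) for [p] and [q] the components of [[X, Y]], and the commutator
    contributes g(p, q). *)
Lemma hol_sec_bismut X Y : hol X -> ahol Y ->
  g (X *m Rm X Y) Y = c * g X Y ^+ 2 + g ([X, Y] *m prhol) [X, Y].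
Proof.
move=> hX hY; rewrite -(Rc_polar hX hY) Rc_Rm.
have prY U : g (U *m prhol) Y = g U Y.
  rewrite -{2}(prholD iota J U) mxformDl.
  rewrite [g (U *m prahol) Y](mxform_ahol iota2 GJ) ?addr0 //.
  exact: ahol_prahol.
have hp : hol ([X, Y] *m prhol) by exact: hol_prhol.
have cyc := tri_cycle Gsym br_anti br_skew.
set p := [X, Y] *m prhol.
have pp : g [X, Y] [X, Y] = 2 * g p [X, Y].
  have pqE := prholD iota J [X, Y]; rewrite -/p in pqE.
  set q := [X, Y] *m prahol in pqE; have hq : ahol q by exact: ahol_prahol.
  rewrite -pqE !mxformDl !mxformDr (mxform_hol iota2 GJ hp hp)
    (mxform_ahol iota2 GJ hq hq).
  by rewrite (mxform_sym Gsym q p); ring.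
have e1 : g (X *m A [X, Y]) Y = 2 * g p [X, Y].
  by rewrite (Jpart_hol _ iota2) // prY cyc pp.
have e2 : X *m A X = 0 by rewrite (Jpart_hol _ iota2) // br_alt ?mul0mx.
have e3 : g (X *m A Y *m A X) Y = g p [X, Y].
  rewrite (Jpart_hol (ad Y) iota2) // br_anti mulNmx -/p mulNmx mxformNl.
  by rewrite (Jpart_hol (ad X) iota2) // prY br_skew opprK.
rewrite !mulmxDr !mulmxN !mulmxA e2 mul0mx subr0 !mxformDl mxformNl e1 e3.
ring.
Qed.

Lemma dual_vector Z : hol Z -> Z != 0 ->
  exists2 Y, ahol Y & g Z Y != 0 /\
    ((forall X, hol X -> [X, Z] = 0) -> forall X, hol X -> [X, Y] *m prhol = 0).
Proof.
move=> hZ Z0; exists (bar Z); first exact: bar_hol.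
split; first exact: G_pos.
move=> Zc X hX; apply: (hol_eq0 iota2 J2 Gu GJ); first exact: hol_prhol.
move=> W hW; have hW' := bar_ahol hW.
have -> : [X, bar Z] *m prhol = [X, bar Z] - [X, bar Z] *m prahol.
  by rewrite -{2}(prholD iota J [X, bar Z]) addrK.
rewrite mxformBl [X in _ - X](mxform_ahol iota2 GJ) ?subr0 //;
  last exact: ahol_prahol.
rewrite (tri_cycle Gsym br_anti br_skew) -(barK W) br_bar br_anti Zc //.
by rewrite oppr0 map_mx0 mxform0r.
Qed.

(** The torsion vanishes on pairs of (1,0)-vectors, so by conjugation on pairs
    of (0,1)-vectors.  A 3-form has two arguments of the same type in each of
    its components, so none is left. *)
Theorem torsion_eq0 X Y : [X, Y] = 0.
Proof.
have ab : forall U V, hol U -> hol V -> [U, V] = 0.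
  move=> U V; apply: (hol_abelian (Rm := Rm) iota2 J2 Gsym Gu GJ) => //.
  - exact: hol_sec_bismut.
  - exact: c0.
  - exact: dual_vector.
have abb U V : ahol U -> ahol V -> [U, V] = 0.
  move=> hU hV; rewrite -(barK U) -(barK V) br_bar ab ?map_mx0 //;
    exact: bar_ahol.
have cyc := tri_cycle Gsym br_anti br_skew.
have mixed U V : hol U -> ahol V -> [U, V] = 0.
  move=> hU hV; apply: (row_free_inj (A := G)); rewrite ?row_free_unit //.
  rewrite mul0mx; apply/rowP => j; rewrite [RHS]mxE.
  have : g [U, V] (delta_mx 0 j) = 0.
    rewrite -(prholD iota J (delta_mx 0 j)) mxformDr br_skew ab ?mxform0r
      ?oppr0 ?add0r //.
      by rewrite cyc abb ?mxform0r //; exact: ahol_prahol.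
    exact: hol_prhol.
  by rewrite /mxform trmx_delta -colE mxE.
have hX := hol_prhol iota2 J2 X; have hX' := ahol_prahol iota2 J2 X.
have hY := hol_prhol iota2 J2 Y; have hY' := ahol_prahol iota2 J2 Y.
rewrite -(prholD iota J X) -(prholD iota J Y) linearD /= mulmxDl !mulmxDr.
rewrite (ab _ _ hX hY) (abb _ _ hX' hY') (mixed _ _ hX hY').
by rewrite (br_anti (X *m prahol)) (mixed _ _ hY hX') oppr0 !addr0.
Qed.

End HermitianTorsion.

Import numFieldNormedType.Exports.
Local Open Scope classical_set_scope.
Local Open Scope complex_scope.

(** * Symmetry of mixed partial derivatives *)

Lemma dist_le_half (R : realFieldType) (a b z e : R) :
  `|a - z| < e / 2 -> `|b - z| < e / 2 -> `|a - b| <= e.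
Proof.
move=> /ltW az; rewrite distrC => /ltW bz; apply: le_trans (ler_distD z _ _) _.
by rewrite [leRHS]splitr lerD.
Qed.

Section Schwarz.
Variables (R : realType) (V : normedModType R).

Lemma is_derive_line (f : V -> R) (x u : V) (s : R) :
  derivable f (x + s *: u) u ->
  is_derive s 1 (fun s : R => f (x + s *: u)) ('D_u f (x + s *: u)).
Proof.
move=> df.
have E : (fun h : R => h^-1 *:
    (((fun s : R => f (x + s *: u)) \o shift s) (h *: 1) - f (x + s *: u)))
  = (fun h : R => h^-1 *:
    ((f \o shift (x + s *: u)) (h *: u) - f (x + s *: u))).
  apply/funext => h /=; congr (_ *: (f _ - _)).
  by rewrite [h *: _]mulr1 scalerDl addrCA.
by apply: DeriveDef; rewrite /derivable /derive E.
Qed.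

(** Two applications of the mean value theorem. *)
Lemma second_difference (f : V -> R) (x u v : V) (h : R) : 0 < h ->
  (forall s t, 0 <= s <= h -> 0 <= t <= h ->
     derivable f (x + t *: v + s *: u) u) ->
  (forall s t, 0 <= s <= h -> 0 <= t <= h ->
     derivable ('D_u f) (x + s *: u + t *: v) v) ->
  exists s t, [/\ 0 <= s <= h, 0 <= t <= h &
    f (x + h *: v + h *: u) - f (x + h *: v) - f (x + h *: u) + f x
    = 'D_v ('D_u f) (x + s *: u + t *: v) * h ^+ 2].
Proof.
move=> h0 du duv.
have hh : 0 <= h <= h by apply/andP; split; lra.
have h00 : 0 <= (0 : R) <= h by apply/andP; split; lra.
pose phi s := f (x + h *: v + s *: u) - f (x + 0 *: v + s *: u).
have phi' s : 0 <= s <= h -> is_derive s 1 phi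
    ('D_u f (x + h *: v + s *: u) - 'D_u f (x + 0 *: v + s *: u)).
  by move=> sh; apply: is_deriveB; apply: is_derive_line; exact: du.
have [||s] := @MVT R phi
    (fun s => 'D_u f (x + h *: v + s *: u) - 'D_u f (x + 0 *: v + s *: u))
      0 h h0.
- move=> s; rewrite in_itv /= => /andP[s0 sh]; apply: phi'.
  by apply/andP; split; lra.
- apply: derivable_within_continuous => s; rewrite in_itv /= => sh.
  by have [] := phi' s sh.
rewrite in_itv /= => /andP[s0 sh] phiE.
have sI : 0 <= s <= h by apply/andP; split; lra.
pose psi t := 'D_u f (x + s *: u + t *: v).
have psi' t : 0 <= t <= h ->
    is_derive t 1 psi ('D_v ('D_u f) (x + s *: u + t *: v)).
  by move=> th; apply: is_derive_line; exact: duv.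
have [||t] := @MVT R psi (fun t => 'D_v ('D_u f) (x + s *: u + t *: v)) 0 h h0.
- move=> t; rewrite in_itv /= => /andP[t0 th]; apply: psi'.
  by apply/andP; split; lra.
- apply: derivable_within_continuous => t; rewrite in_itv /= => th.
  by have [] := psi' t th.
rewrite in_itv /= => /andP[t0 th] psiE.
exists s, t; split=> //; first by apply/andP; split; lra.
move: phiE psiE; rewrite /phi /psi !scale0r !addr0 !subr0.
move=> e1 e2; rewrite (addrAC x (s *: u) (h *: v)) in e2.
by rewrite expr2 mulrA -e2 -e1; ring.
Qed.

(** The second difference over a small square is a value of either mixed
    derivative near [x]; both are continuous at [x]. *)
Lemma schwarz (f : V -> R) (U : set V) (x u v : V) : open U -> U x ->
  (forall y, U y -> derivable f y u) -> (forall y, U y -> derivable f y v) ->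
  (forall y, U y -> derivable ('D_u f) y v) ->
  (forall y, U y -> derivable ('D_v f) y u) ->
  {for x, continuous ('D_v ('D_u f))} -> {for x, continuous ('D_u ('D_v f))} ->
  'D_v ('D_u f) x = 'D_u ('D_v f) x.
Proof.
move=> oU Ux du dv duv dvu cuv cvu.
apply/eqP; rewrite -subr_eq0 -normr_le0; apply/ler_addgt0Pr => e e0.
rewrite add0r.
have e20 : 0 < e / 2 by rewrite divr_gt0.
have nU : nbhs x U by apply: open_nbhs_nbhs; split.
have n1 : \forall t \near x, `|'D_v ('D_u f) x - 'D_v ('D_u f) t| < e / 2.
  by apply: (cvgrPdist_lt _ _).1 cuv _ e20.
have n2 : \forall t \near x, `|'D_u ('D_v f) x - 'D_u ('D_v f) t| < e / 2.
  by apply: (cvgrPdist_lt _ _).1 cvu _ e20.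
have nn := @filterI _ (nbhs x) _ _ _ nU (@filterI _ (nbhs x) _ _ _ n1 n2).
have [r /= r0 br] := (nbhs_ballP _ _).1 (nn _ _).
pose h := r / (2 * (`|u| + `|v| + 1)).
have den0 : 0 < `|u| + `|v| + 1 by rewrite ltr_wpDl ?addr_ge0.
have h0 : 0 < h by rewrite divr_gt0 // mulr_gt0.
have inb s t : 0 <= s <= h -> 0 <= t <= h -> ball x r (x + s *: u + t *: v).
  move=> /andP[s0 sh] /andP[t0 th]; rewrite -ball_normE /ball_ /=.
  rewrite -addrA opprD addrA subrr sub0r normrN.
  apply: le_lt_trans (ler_normD _ _) _; rewrite !normrZ !ger0_norm //.
  apply: (@le_lt_trans _ _ (h * (`|u| + `|v|))).
    by rewrite mulrDr lerD // ler_wpM2r.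
  apply: (@lt_le_trans _ _ (h * (2 * (`|u| + `|v| + 1)))).
    by rewrite ltr_pM2l //; have := normr_ge0 u; have := normr_ge0 v; lra.
  by rewrite /h divfK // mulf_neq0 // gt_eqF.
have inb' s t : 0 <= s <= h -> 0 <= t <= h -> ball x r (x + t *: v + s *: u).
  by rewrite addrAC; exact: inb.
have [||s1 [t1 [s1h t1h D1]]] := @second_difference f x u v h h0.
- by move=> s t sh th; apply: du; case: (br _ (inb' _ _ sh th)).
- by move=> s t sh th; apply: duv; case: (br _ (inb _ _ sh th)).
have [||s2 [t2 [s2h t2h D2]]] := @second_difference f x v u h h0.
- by move=> s t sh th; apply: dv; case: (br _ (inb _ _ th sh)).
- by move=> s t sh th; apply: dvu; case: (br _ (inb' _ _ th sh)).
have D12 : 'D_v ('D_u f) (x + s1 *: u + t1 *: v)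
    = 'D_u ('D_v f) (x + s2 *: v + t2 *: u).
  rewrite (addrAC x (h *: u) (h *: v)) (addrAC (f (x + h *: v + h *: u))) in D2.
  have cancel (k a b d : R) : k != 0 -> d = a * k -> d = b * k -> a = b.
    by move=> k0 -> /(mulIf k0).
  by apply: cancel D1 D2; rewrite expf_neq0 // gt_eqF.
have [_ [b1 _]] := br _ (inb _ _ s1h t1h).
have [_ [_ b2]] := br _ (inb' _ _ t2h s2h).
apply: dist_le_half b2; move: b1; rewrite /= D12; exact.
Qed.
End Schwarz.

(** * Smooth maps and derivatives of matrix products *)

Lemma near_open (T : topologicalType) (U : set T) (P : T -> Prop) x :
  open U -> U x -> (forall y, U y -> P y) -> \forall y \near x, P y.
Proof.
by move=> oU Ux UP; apply: filterS UP _; apply: open_nbhs_nbhs; split.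
Qed.

Lemma continuous_open_ext (T W : topologicalType) (U : set T) (f g : T -> W) x :
  open U -> U x -> (forall y, U y -> f y = g y) ->
  {for x, continuous f} -> {for x, continuous g}.
Proof.
move=> oU Ux fg cf; suff : g @ x --> g x by [].
rewrite -(fg _ Ux).
apply: cvg_trans cf; apply: near_eq_cvg.
by apply: (near_open oU Ux) => y Uy; rewrite fg.
Qed.

Section SmoothMaps.
Variables (R : realType) (m : nat).
Implicit Types (U : set 'rV[R]_m).

Lemma Ck_ext (V : normedModType R) k U (f g : 'rV[R]_m -> V) : open U ->
  (forall x, U x -> f x = g x) -> Ck k U f -> Ck k U g.
Proof.
move=> oU.
have cg f' g' : (forall x, U x -> f' x = g' x) ->
    (forall x, U x -> {for x, continuous f'}) ->
    forall x, U x -> {for x, continuous (g' : 'rV[R]_m -> V)}.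
  by move=> fg cf x Ux; apply: (continuous_open_ext oU Ux fg); exact: cf.
elim: k f g => [|k IH] f g fg /= [cf df].
  by split=> // x Ux; apply: (cg f g fg cf).
split=> [x Ux|i]; first exact: (cg f g fg cf).
have [dfi Cfi] := df i; split=> [x Ux|].
  apply: near_eq_derivable (dfi x Ux).
  by apply: (near_open oU Ux) => y Uy; rewrite fg.
apply: IH Cfi => x Ux; apply: near_eq_derive.
by apply: (near_open oU Ux) => y Uy; rewrite fg.
Qed.

Lemma Ck_coord p q k U (f : 'rV[R]_m -> 'M[R]_(p, q)) a b : open U ->
  Ck k U f -> Ck k U (fun x => f x a b).
Proof.
move=> oU; elim: k f => [|k IH] f [cf df].
  split=> // x Ux.
  apply: (continuous_comp (g := fun M : 'M[R]_(p, q) => M a b)).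
    exact: cf.
  exact: coord_continuous.
split=> [x Ux|i].
  apply: (continuous_comp (g := fun M : 'M[R]_(p, q) => M a b)).
    exact: cf.
  exact: coord_continuous.
have [dfi Cfi] := df i; split=> [x Ux|].
  by have /derivable_mxP := dfi x Ux.
apply: Ck_ext (IH _ Cfi) => // x Ux.
by rewrite derive_mx ?mxE //; exact: dfi.
Qed.

Lemma CkB (V : normedModType R) k U (f g : 'rV[R]_m -> V) : open U ->
  Ck k U f -> Ck k U g -> Ck k U (fun x => f x - g x).
Proof.
move=> oU; elim: k f g => [|k IH] f g [cf df] [cg dg].
  by split=> // x Ux; apply: continuousB; [exact: cf|exact: cg].
split=> [x Ux|i]; first by apply: continuousB; [exact: cf|exact: cg].
have [dfi Cfi] := df i; have [dgi Cgi] := dg i; split=> [x Ux|].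
  by apply: derivableB; [exact: dfi|exact: dgi].
apply: Ck_ext (IH _ _ Cfi Cgi) => // x Ux.
by rewrite deriveB //; [exact: dfi|exact: dgi].
Qed.

Lemma Ck_cst (V : normedModType R) k U (v : V) : Ck k U (fun=> v : V).
Proof.
elim: k v => [|k IH] v.
  by split=> // x _; exact: cst_continuous.
split=> [x _|i]; first exact: cst_continuous.
split=> [x _|]; first exact: derivable_cst.
have -> : (fun x => 'D_(evec R i) (fun _ : 'rV[R]_m => v) x) = (fun _ => 0).
  by apply/funext => x; rewrite derive_cst.
exact: IH.
Qed.

Lemma Ck_schwarz U (f : 'rV[R]_m -> R) i j x : open U -> U x -> Ck 2 U f ->
  'D_(evec R j) ('D_(evec R i) f) x = 'D_(evec R i) ('D_(evec R j) f) x.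
Proof.
move=> oU Ux [_ d].
have [di [_ /(_ j)[dji [cji _]]]] := d i.
have [dj [_ /(_ i)[dij [cij _]]]] := d j.
exact: (schwarz oU Ux di dj dji dij (cji _ Ux) (cij _ Ux)).
Qed.

End SmoothMaps.

Section MatrixCalculus.
Variables (R : realType) (V : normedModType R).
Implicit Types (x v : V).

Lemma is_derive_mx p q (f : V -> 'M[R]_(p, q)) x v (df : 'M[R]_(p, q)) :
  (forall a b, is_derive x v (fun y => f y a b) (df a b)) -> is_derive x v f df.
Proof.
move=> d; have dv : derivable f x v.
  by apply/derivable_mxP => a b; have [] := d a b.
apply: DeriveDef => //; rewrite derive_mx //; apply/matrixP => a b; rewrite mxE.
by have [_ ->] := d a b.
Qed.

Lemma is_derive_coord p q (f : V -> 'M[R]_(p, q)) x v (df : 'M[R]_(p, q)) a b :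
  is_derive x v f df -> is_derive x v (fun y => f y a b) (df a b).
Proof.
move=> [dv <-]; apply: DeriveDef; first by have /derivable_mxP := dv.
by rewrite derive_mx // mxE.
Qed.

Lemma is_derive_mulmx p q r (f : V -> 'M[R]_(p, q)) (h : V -> 'M[R]_(q, r))
  x v df dh :
  is_derive x v f df -> is_derive x v h dh ->
  is_derive x v (fun y => f y *m h y) (df *m h x + f x *m dh).
Proof.
move=> fd hd; apply: is_derive_mx => a b.
have -> : (fun y => (f y *m h y) a b) =
    \sum_(j < q) (fun y => f y a j) * (fun y => h y j b).
  by apply/funext => y; rewrite mxE fct_sumE.
have D : is_derive x v (\sum_(j < q) (fun y => f y a j) * (fun y => h y j b))
    (\sum_(j < q) (f x a j *: dh j b + h x j b *: df a j)).
  by apply: is_derive_sum => j; apply: is_deriveM; exact: is_derive_coord.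
apply: (is_derive_eq D).
rewrite !mxE -big_split /=; apply: eq_bigr => j _.
by rewrite addrC; congr (_ + _); rewrite [LHS]mulrC.
Qed.

Lemma is_derive_tr p q (f : V -> 'M[R]_(p, q)) x v df :
  is_derive x v f df -> is_derive x v (fun y => (f y)^T) df^T.
Proof.
move=> fd; apply: is_derive_mx => a b; rewrite mxE.
have -> : (fun y => (f y)^T a b) = (fun y => f y b a).
  by apply/funext => y; rewrite mxE.
exact: is_derive_coord.
Qed.

Lemma is_derive_scale p q (k : V -> R) (f : V -> 'M[R]_(p, q)) x v dk df :
  is_derive x v k dk -> is_derive x v f df ->
  is_derive x v (fun y => k y *: f y) (dk *: f x + k x *: df).
Proof.
move=> kd fd; apply: is_derive_mx => a b.
have -> : (fun y => (k y *: f y) a b) = k * (fun y => f y a b).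
  by apply/funext => y; rewrite mxE.
apply: is_derive_eq; first by apply: is_deriveM => //;
  exact: is_derive_coord fd.
by rewrite !mxE addrC; congr (_ + _); rewrite [LHS]mulrC.
Qed.

End MatrixCalculus.

(** * The Ricci and Bianchi identities for parallel torsion *)

(** Proves identities between sums of matrix products and transposes, treating
    each product and each transpose as an atom. *)
Ltac mx_ring :=
  repeat match goal with |- context [mulmx ?A ?B] =>
    let x := fresh in set x := (mulmx A B); clearbody x end;
  repeat match goal with |- context [trmx ?A] =>
    let x := fresh in set x := (trmx A); clearbody x end;
  let a := fresh in let b := fresh in
  apply/matrixP => a b; rewrite ?mxE; ring.

Section Contraction.
Variables (F : comNzRingType) (m p q : nat).

(** The linear map sending the k-th basis vector to [M k]. *)
Definition contr (M : 'I_m -> 'M[F]_(p, q)) (u : 'rV[F]_m) : 'M[F]_(p, q) :=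
  \sum_k u 0 k *: M k.

Lemma contr_delta M k : contr M (delta_mx 0 k) = M k.
Proof.
rewrite /contr (bigD1 k) //= mxE !eqxx scale1r big1 ?addr0 // => l lk.
by rewrite mxE eqxx (negPf lk) scale0r.
Qed.

Lemma contr0 M : contr M 0 = 0.
Proof. by rewrite /contr big1 // => k _; rewrite mxE scale0r. Qed.

Lemma contrP M a u v : contr M (a *: u + v) = a *: contr M u + contr M v.
Proof.
rewrite /contr scaler_sumr -big_split; apply: eq_bigr => k _ /=.
by rewrite !mxE scalerDl scalerA.
Qed.

Lemma contrB M u v : contr M (u - v) = contr M u - contr M v.
Proof. by rewrite addrC -scaleN1r contrP scaleN1r addrC. Qed.

HB.instance Definition _ M := GRing.isLinear.Build F _ _ _ (contr M) (contrP M).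

End Contraction.

(** The Ricci identity for a parallel bilinear form [G]: the hypothesis equates
    the two mixed second derivatives of [G], the first ones being
    [A *m G + G *m A^T] and [B *m G + G *m B^T]. *)
Lemma ricci_form (F : comNzRingType) m (A B A' B' G : 'M[F]_m) :
  A' *m G + A *m (B *m G + G *m B^T) + ((B *m G + G *m B^T) *m A^T + G *m A'^T)
  = B' *m G + B *m (A *m G + G *m A^T)
    + ((A *m G + G *m A^T) *m B^T + G *m B'^T) ->
  (B' - A' + B *m A - A *m B) *m G + G *m (B' - A' + B *m A - A *m B)^T = 0.
Proof.
move/eqP; rewrite eq_sym -subr_eq0 => /eqP E; rewrite -[RHS]E {E}.
rewrite !raddfB raddfD raddfB /= !trmx_mul.
rewrite !(mulmxDl, mulmxDr, mulNmx, mulmxN, mulmxA).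
mx_ring.
Qed.

(** The Ricci identity for a parallel bracket, [T] being bracketing with a basis
    vector.  [LA] and [LB] stand for bracketing with the derivatives of that
    vector, [L1] and [L2] with its second derivatives. *)
Lemma ricci_bracket (F : comNzRingType) m (A B A' B' T LA LB L1 L2 : 'M[F]_m) :
  L1 + B *m LA - LA *m B + (A' *m T + A *m (LB + B *m T - T *m B))
    - ((LB + B *m T - T *m B) *m A + T *m A')
  = L2 + A *m LB - LB *m A + (B' *m T + B *m (LA + A *m T - T *m A))
    - ((LA + A *m T - T *m A) *m B + T *m B') ->
  L2 - L1 = T *m (B' - A' + B *m A - A *m B) - (B' - A' + B *m A - A *m B) *m T.
Proof.
move/eqP; rewrite -subr_eq0 => /eqP E; rewrite -[LHS]addr0 -E {E}.
rewrite !(mulmxDl, mulmxDr, mulNmx, mulmxN, mulmxA).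
mx_ring.
Qed.

Lemma row_contr (F : comNzRingType) m p q (M : 'I_m -> 'M[F]_(p, q)) u v :
  v *m contr M u = \sum_i \sum_j (u 0 i * v 0 j) *: row j (M i).
Proof.
rewrite /contr mulmx_sumr; apply: eq_bigr => i _.
rewrite -scalemxAr mulmx_sum_row scaler_sumr; apply: eq_bigr => j _.
by rewrite scalerA.
Qed.

Section ChartMatrices.
Variables (R : realType) (m : nat).
Implicit Types (Gam : christoffel R m) (x u v : 'rV[R]_m).

(** The covariant derivative along the k-th coordinate field acts on row vectors
    through the right multiplication by [cmat Gam x k]; similarly [tmat] is the
    torsion and [rmat] the curvature. *)
Definition cmat Gam x (k : 'I_m) : 'M[R]_m := \matrix_j Gam x k j.
Definition tmat Gam x (k : 'I_m) : 'M[R]_m := \matrix_j (Gam x k j - Gam x j k).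
Definition rmat Gam x (i j : 'I_m) : 'M[R]_m :=
  'D_(evec R i) (fun y => cmat Gam y j) x
  - 'D_(evec R j) (fun y => cmat Gam y i) x
  + cmat Gam x j *m cmat Gam x i - cmat Gam x i *m cmat Gam x j.

Lemma rmat_anti Gam x i j : rmat Gam x i j = - rmat Gam x j i.
Proof.
rewrite /rmat; move: (derive _ x (evec R i)) (derive _ x (evec R j)) => D1 D2.
mx_ring.
Qed.

Lemma chrisE Gam x u v : chris Gam x u v = v *m contr (cmat Gam x) u.
Proof.
rewrite row_contr; apply: eq_bigr => i _; apply: eq_bigr => j _.
by rewrite rowK.
Qed.

Lemma chris_coord Gam x i j : chris Gam x (evec R i) (evec R j) = Gam x i j.
Proof. by rewrite chrisE contr_delta -rowE rowK. Qed.

Lemma torsionE Gam X Y x : torsion Gam X Y x = Y x *m contr (tmat Gam x) (X x).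
Proof.
have -> : torsion Gam X Y x = chris Gam x (X x) (Y x) - chris Gam x (Y x) (X x).
  rewrite /torsion /nabla /lie_bracket.
  by move: ('D__ Y x) ('D__ X x) (chris _ _ _ _) (chris _ _ _ _) => a b c d;
    mx_ring.
rewrite /chris row_contr [X in _ - X]exchange_big -sumrB; apply: eq_bigr => i _.
rewrite -sumrB; apply: eq_bigr => j _.
by rewrite rowK scalerBr [Y x 0 j * _]mulrC.
Qed.

Lemma nabla_coord Gam i j :
  nabla Gam (coord_field i) (coord_field j) = fun x => Gam x i j.
Proof.
apply/funext => x; rewrite /nabla chris_coord /coord_field.
by rewrite derive_cst add0r.
Qed.

Lemma is_derive_row x v (f : 'rV[R]_m -> 'M[R]_m) k (df : 'M[R]_m) :
  is_derive x v f df -> is_derive x v (fun y => row k (f y)) (row k df).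
Proof.
move=> fd; apply: is_derive_mx => a b; rewrite mxE.
have -> : (fun y => row k (f y) a b) = (fun y => f y k b).
  by apply/funext => y; rewrite mxE.
exact: is_derive_coord.
Qed.

Lemma derive_row x v (f : 'rV[R]_m -> 'M[R]_m) k (df : 'M[R]_m) :
  is_derive x v f df -> 'D_v (fun y => row k (f y)) x = row k df.
Proof.
by move/is_derive_row => /(_ k)[_ ->].
Qed.

Lemma curvatureE Gam x i j k :
  (forall l v : 'I_m, derivable (fun y => cmat Gam y l) x (evec R v)) ->
  curvature Gam (coord_field i) (coord_field j) (coord_field k) x
  = row k (rmat Gam x i j).
Proof.
move=> dC; rewrite /curvature !nabla_coord.
have -> : nabla Gam (lie_bracket (coord_field i) (coord_field j))
    (coord_field k) x = 0.
  rewrite /nabla /lie_bracket /coord_field !derive_cst subrr chrisE contr0.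
  by rewrite mulmx0 addr0.
have Drow l (v : 'I_m) : 'D_(evec R v) (fun y => Gam y l k) x
    = row k ('D_(evec R v) (fun y => cmat Gam y l) x).
  have -> : (fun y => Gam y l k) = (fun y => row k (cmat Gam y l)).
    by apply/funext => y; rewrite rowK.
  by apply: derive_row; exact: derivableP.
have chrisr l (v : 'I_m) : chris Gam x (evec R v) (Gam x l k)
  = row k (cmat Gam x l *m cmat Gam x v).
  by rewrite chrisE contr_delta row_mul rowK.
rewrite /nabla /coord_field !Drow !chrisr subr0 /rmat.
rewrite ![row k (_ + _)]linearD /= ![row k (- _)]linearN /=.
mx_ring.
Qed.

Lemma nabla_torsionE Gam x i k l :
  (forall l v : 'I_m, derivable (fun y => tmat Gam y l) x (evec R v)) ->
  nabla_torsion Gam (coord_field i) (coord_field k) (coord_field l) x =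
  row l ('D_(evec R i) (fun y => tmat Gam y k) x + tmat Gam x k *m cmat Gam x i
    - contr (tmat Gam x) (row k (cmat Gam x i)) - cmat Gam x i *m tmat Gam x k).
Proof.
move=> dT; rewrite /nabla_torsion !torsionE !nabla_coord /nabla.
have -> : torsion Gam (coord_field k) (coord_field l)
  = fun y => row l (tmat Gam y k).
  by apply/funext => y; rewrite torsionE /coord_field contr_delta -rowE.
rewrite (derive_row _ (derivableP (dT _ _))) chrisE /coord_field.
rewrite !contr_delta -!rowE.
by rewrite !raddfB raddfD /= !row_mul !rowK.
Qed.

Lemma tmatE Gam x i j :
  row j (tmat Gam x i) = row j (cmat Gam x i) - row i (cmat Gam x j).
Proof. by rewrite !rowK. Qed.

End ChartMatrices.

Section Integrability.
Variables (R : realType) (m : nat) (U : set 'rV[R]_m).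
Hypothesis oU : open U.
Local Notation e := (evec R).

(** Two expressions [df] and [dg] for the first derivatives of [f] have the same
    cross derivatives. *)
Lemma mx_schwarz p q (f : 'rV[R]_m -> 'M[R]_(p, q)) i j
    (df dg : 'rV[R]_m -> 'M[R]_(p, q)) (ddf ddg : 'M[R]_(p, q)) x :
  U x -> (forall a b, Ck 2 U (fun y => f y a b)) ->
  (forall y, U y -> is_derive y (e i) f (df y)) ->
  (forall y, U y -> is_derive y (e j) f (dg y)) ->
  is_derive x (e j) df ddf -> is_derive x (e i) dg ddg -> ddf = ddg.
Proof.
move=> Ux f2 fi fj dfj dgi; apply/matrixP => a b.
have E k (h : 'rV[R]_m -> 'M[R]_(p, q)) (dh : 'M[R]_(p, q)) l :
    (forall y, U y -> is_derive y (e k) f (h y)) -> is_derive x (e l) h dh ->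
    dh a b = 'D_(e l) ('D_(e k) (fun y => f y a b)) x.
  move=> fk hl; have [_ <-] := is_derive_coord a b hl.
  apply: near_eq_derive; apply: (near_open oU Ux) => y Uy.
  by have [_ ->] := is_derive_coord a b (fk _ Uy).
rewrite (E _ _ _ _ fi dfj) (E _ _ _ _ fj dgi).
exact: (Ck_schwarz _ _ oU Ux (f2 a b)).
Qed.

Variable C : 'I_m -> 'rV[R]_m -> 'M[R]_m.
Hypothesis dC : forall k i y, U y -> derivable (C k) y (e i).

Definition curv x i j : 'M[R]_m :=
  'D_(e i) (C j) x - 'D_(e j) (C i) x + C j x *m C i x - C i x *m C j x.

(** Curvature endomorphisms are skew for a parallel metric. *)
Lemma curv_metric (G : 'rV[R]_m -> 'M[R]_m) x i j : U x ->
  (forall a b, Ck 2 U (fun y => G y a b)) ->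
  (forall k y, U y -> is_derive y (e k) G (C k y *m G y + G y *m (C k y)^T)) ->
  curv x i j *m G x + G x *m (curv x i j)^T = 0.
Proof.
move=> Ux G2 dG.
have dd k l : is_derive x (e l) (fun y => C k y *m G y + G y *m (C k y)^T)
   ('D_(e l) (C k) x *m G x + C k x *m (C l x *m G x + G x *m (C l x)^T)
    + ((C l x *m G x + G x *m (C l x)^T) *m (C k x)^T
       + G x *m ('D_(e l) (C k) x)^T)).
  have /derivableP dCk : derivable (C k) x (e l) by exact: dC.
  apply: is_deriveD; apply: is_derive_mulmx => //; [exact: dG|exact: dG|].
  exact: is_derive_tr.
exact: ricci_form (mx_schwarz Ux G2 (dG i) (dG j) (dd i j) (dd j i)).
Qed.

Variable T : 'I_m -> 'rV[R]_m -> 'M[R]_m.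
Hypothesis T2 : forall k a b, Ck 2 U (fun y => T k y a b).
Hypothesis dT : forall i k y, U y -> is_derive y (e i) (T k)
  (contr (T^~ y) (row k (C i y)) + C i y *m T k y - T k y *m C i y).

Lemma contr_mul x (v : 'rV[R]_m) k :
  contr (fun l => contr (T^~ x) (row l (C k x))) v = contr (T^~ x) (v *m C k x).
Proof.
rewrite /contr [in RHS](eq_bigr (fun l => \sum_i (v 0 i * C k x i l) *: T l x)).
  rewrite exchange_big; apply: eq_bigr => i _ /=; rewrite scaler_sumr.
  by apply: eq_bigr => l _; rewrite mxE scalerA.
by move=> l _; rewrite mxE scaler_suml.
Qed.

Lemma contr_mulmxl (A : 'M[R]_m) (M : 'I_m -> 'M[R]_m) (v : 'rV[R]_m) :
  contr (fun l => A *m M l) v = A *m contr M v.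
Proof.
by rewrite /contr mulmx_sumr; apply: eq_bigr => i _; rewrite scalemxAr.
Qed.

Lemma contr_mulmxr (A : 'M[R]_m) (M : 'I_m -> 'M[R]_m) (v : 'rV[R]_m) :
  contr (fun l => M l *m A) v = contr M v *m A.
Proof.
by rewrite /contr mulmx_suml; apply: eq_bigr => i _; rewrite scalemxAl.
Qed.

(** Leibniz rule for the parallel bracket applied to a moving vector [v]. *)
Lemma is_derive_contr x i v dv : U x -> is_derive x (e i) v dv ->
  is_derive x (e i) (fun y => contr (T^~ y) (v y))
   (contr (T^~ x) (dv + v x *m C i x) + C i x *m contr (T^~ x) (v x)
     - contr (T^~ x) (v x) *m C i x).
Proof.
move=> Ux vd.
have D : is_derive x (e i) (\sum_l (fun y => v y 0 l *: T l y))
  (\sum_l (dv 0 l *: T l x + v x 0 l *: (contr (T^~ x) (row l (C i x))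
    + C i x *m T l x - T l x *m C i x))).
  apply: is_derive_sum => l; apply: is_derive_scale; last exact: dT.
  exact: is_derive_coord.
rewrite fct_sumE in D; apply: (is_derive_eq D).
have -> : contr (T^~ x) (dv + v x *m C i x) = contr (T^~ x) dv +
    contr (fun l => contr (T^~ x) (row l (C i x))) (v x).
  by rewrite contr_mul -{1}[dv]scale1r contrP scale1r.
rewrite -contr_mulmxl -contr_mulmxr big_split /= -!addrA; congr (_ + _).
rewrite /contr -sumrB -big_split; apply: eq_bigr => l _ /=.
by rewrite scalerBr scalerDr addrA.
Qed.

(** Curvature endomorphisms are derivations of a parallel torsion. *)
Lemma curv_torsion x i j k : U x ->
  contr (T^~ x) (row k (curv x i j))
  = T k x *m curv x i j - curv x i j *m T k x.
Proof.
move=> Ux.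
pose Phi l y := contr (T^~ y) (row k (C l y)) + C l y *m T k y - T k y *m C l y.
have dPhi a b : is_derive x (e b) (Phi a)
   ((contr (T^~ x) (row k ('D_(e b) (C a) x) + row k (C a x) *m C b x)
     + C b x *m contr (T^~ x) (row k (C a x))
     - contr (T^~ x) (row k (C a x)) *m C b x
     + ('D_(e b) (C a) x *m T k x + C a x *m Phi b x))
    - (Phi b x *m C a x + T k x *m 'D_(e b) (C a) x)).
  have /derivableP dCa : derivable (C a) x (e b) by exact: dC.
  apply: is_deriveB; last by apply: is_derive_mulmx => //; exact: dT.
  apply: is_deriveD; last by apply: is_derive_mulmx => //; exact: dT.
  by apply: is_derive_contr => //; exact: is_derive_row.
have := mx_schwarz Ux (T2 k) (dT i k) (dT j k) (dPhi i j) (dPhi j i).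
rewrite -!row_mul -!linearD /= => /ricci_bracket <-.
by rewrite -contrB -linearB /= opprD addrACA addrA.
Qed.

Hypothesis T_row : forall i j y, U y ->
  row j (T i y) = row j (C i y) - row i (C j y).

Lemma mul_torsion x (v : 'rV[R]_m) j : U x ->
  v *m T j x = - row j (contr (T^~ x) v).
Proof.
move=> Ux; rewrite rowE row_contr mulmx_sum_row -sumrN; apply: eq_bigr => i _.
rewrite (bigD1 j) //= big1 => [|l lj]; last first.
  by rewrite mxE eqxx (negPf lj) mulr0 scale0r.
by rewrite mxE !eqxx mulr1 addr0 !T_row // -scalerN opprB.
Qed.

(** The first Bianchi identity.  Differentiating [T_row] turns the derivatives
    of the coefficients [C] into one derivative of the torsion, which [dT] makes
    algebraic. *)
Lemma curv_bianchi x i j k : U x ->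
  row k (curv x i j) + row i (curv x j k) + row j (curv x k i) =
  row k (contr (T^~ x) (row j (T i x))) + row i (contr (T^~ x) (row k (T j x)))
  + row j (contr (T^~ x) (row i (T k x))).
Proof.
move=> Ux.
have DC a b c : row c ('D_(e a) (C b) x) = row b ('D_(e a) (C c) x)
   + row c (contr (T^~ x) (row b (C a x)))
   - row b (contr (T^~ x) (row c (C a x)))
   - (row c (C b x) - row b (C c x)) *m C a x.
  have /derivableP dCb : derivable (C b) x (e a) by exact: dC.
  have /derivableP dCc : derivable (C c) x (e a) by exact: dC.
  have [_ e1] := is_deriveB (is_derive_row c dCb) (is_derive_row b dCc).
  have [_ e2] := is_derive_row c (dT a b Ux).
  have E : row c (contr (T^~ x) (row b (C a x))
    + C a x *m T b x - T b x *m C a x)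
      = row c ('D_(e a) (C b) x) - row b ('D_(e a) (C c) x).
    rewrite -e1 -e2; apply: near_eq_derive; apply: (near_open oU Ux) => y Uy.
    exact: T_row.
  have -> : row c ('D_(e a) (C b) x) =
      row c ('D_(e a) (C b) x) - row b ('D_(e a) (C c) x)
      + row b ('D_(e a) (C c) x).
    by rewrite subrK.
  rewrite -E raddfB raddfD /= !row_mul mul_torsion // -T_row //.
  mx_ring.
have rowD l (M N : 'M[R]_m) : row l (M + N) = row l M + row l N.
  exact: linearD.
have rowN l (M : 'M[R]_m) : row l (- M) = - row l M by exact: linearN.
rewrite /curv !T_row // !contrB !(rowD, rowN, row_mul).
rewrite (DC i j k) (DC j k i) (DC k i j) !mulmxBl.
mx_ring.
Qed.

Lemma curv_commute x i j J : U x ->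
  (forall k y, U y -> C k y *m J = J *m C k y) ->
    curv x i j *m J = J *m curv x i j.
Proof.
move=> Ux CJ.
have DJ k l : 'D_(e l) (C k) x *m J = J *m 'D_(e l) (C k) x.
  have /derivableP dCk : derivable (C k) x (e l) by exact: dC.
  have d0 : is_derive x (e l) (fun _ => J) 0 by exact: is_derive_cst.
  have [_ e1] := is_derive_mulmx dCk d0; have [_ e2] := is_derive_mulmx d0 dCk.
  rewrite mulmx0 addr0 in e1; rewrite mul0mx add0r in e2; rewrite -e1 -e2.
  by apply: near_eq_derive; apply: (near_open oU Ux) => y Uy; exact: CJ.
rewrite /curv !(mulmxDl, mulmxDr, mulNmx, mulmxN).
by rewrite -!mulmxA !CJ // !mulmxA !CJ // !DJ.
Qed.

(* [A] is a parallel tensor, by which the connection [C] is modified. *)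
Variable A : 'I_m -> 'rV[R]_m -> 'M[R]_m.
Hypothesis dA : forall i k y, U y -> is_derive y (e i) (A k)
  (contr (A^~ y) (row k (C i y)) + C i y *m A k y - A k y *m C i y).

(** The curvature of [C - A] contains the covariant derivatives of [A], which
    vanish, and the values of [A] on the torsion of [C]. *)
Lemma curv_sub_parallel (C' : 'I_m -> 'rV[R]_m -> 'M[R]_m) x i j : U x ->
  (forall k y, U y -> C' k y = C k y - A k y) ->
  'D_(e i) (C' j) x - 'D_(e j) (C' i) x + C' j x *m C' i x - C' i x *m C' j x =
  curv x i j - contr (A^~ x) (row j (C i x) - row i (C j x))
  + A j x *m A i x - A i x *m A j x.
Proof.
move=> Ux C'E.
have D k l : 'D_(e l) (C' k) x = 'D_(e l) (C k) x
   - (contr (A^~ x) (row k (C l x)) + C l x *m A k x - A k x *m C l x).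
  have /derivableP dCk : derivable (C k) x (e l) by exact: dC.
  have [_ <-] := is_deriveB dCk (dA l k Ux).
  apply: near_eq_derive; apply: (near_open oU Ux) => y Uy.
  exact: C'E.
rewrite !D !C'E // contrB /curv.
rewrite !(mulmxDl, mulmxDr, mulNmx, mulmxN).
mx_ring.
Qed.

End Integrability.

(** * Extension to the complexified tangent space *)

(* Tensor identities known on the coordinate vectors are extended one argument
   at a time. *)
Section LinearExtension.
Variables (F : comNzRingType) (m : nat).

Definition lin (V : lmodType F) (f : 'rV[F]_m -> V) : Prop :=
  forall a X Y, f (a *: X + Y) = a *: f X + f Y.

Lemma lin_id : lin (fun X => X). Proof. by []. Qed.
Lemma linD (V : lmodType F) (f h : 'rV[F]_m -> V) :
  lin f -> lin h -> lin (fun X => f X + h X).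
Proof. by move=> lf lh a X Y; rewrite lf lh scalerDr addrACA. Qed.
Lemma linN (V : lmodType F) (f : 'rV[F]_m -> V) : lin f -> lin (fun X => - f X).
Proof. by move=> lf a X Y; rewrite lf opprD scalerN. Qed.
Lemma linZ (V : lmodType F) b (f : 'rV[F]_m -> V) :
  lin f -> lin (fun X => b *: f X).
Proof. by move=> lf a X Y; rewrite lf scalerDr !scalerA mulrC. Qed.
Lemma linMl p q r (A : 'M[F]_(p, q)) (f : 'rV[F]_m -> 'M[F]_(q, r)) :
  lin f -> lin (fun X => A *m f X).
Proof. by move=> lf a X Y; rewrite lf mulmxDr -scalemxAr. Qed.
Lemma linMr p q r (A : 'M[F]_(q, r)) (f : 'rV[F]_m -> 'M[F]_(p, q)) :
  lin f -> lin (fun X => f X *m A).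
Proof. by move=> lf a X Y; rewrite lf mulmxDl -scalemxAl. Qed.
Lemma lin_contr n p q (M : 'I_n -> 'M[F]_(p, q)) (f : 'rV[F]_m -> 'rV[F]_n) :
  lin f -> lin (fun X => contr M (f X)).
Proof. by move=> lf a X Y; rewrite lf contrP. Qed.
Lemma lin_contr2 n p q (M : 'I_n -> 'I_m -> 'M[F]_(p, q)) Z :
  lin (fun Y : 'rV[F]_m => contr (fun i => contr (M i) Y) Z).
Proof.
move=> a X Y; rewrite /contr scaler_sumr -big_split; apply: eq_bigr => i _ /=.
by rewrite -/(contr (M i) _) contrP scalerDr !scalerA mulrC.
Qed.

Lemma lin_ext (V : lmodType F) (f h : 'rV[F]_m -> V) : lin f -> lin h ->
  (forall k, f (delta_mx 0 k) = h (delta_mx 0 k)) -> forall X, f X = h X.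
Proof.
have sum0 (f' : 'rV[F]_m -> V) : lin f' -> f' 0 = 0.
  by move=> lf; have := lf (-1) 0 0; rewrite scaler0 addr0 scaleN1r addNr.
have sumE (f' : 'rV[F]_m -> V) X : lin f' ->
    f' X = \sum_i X 0 i *: f' (delta_mx 0 i).
  move=> lf; rewrite {1}(row_sum_delta X).
  rewrite (big_morph f' (id1 := 0) (op1 := +%R)) ?sum0 //.
    by apply: eq_bigr => i _; rewrite -[_ *: _ in LHS]addr0 lf sum0 ?addr0.
  by move=> x y; rewrite -[x]scale1r lf !scale1r.
move=> lf lh fh X; rewrite (sumE f) // (sumE h) //.
by apply: eq_bigr => i _; rewrite fh.
Qed.

End LinearExtension.

Ltac lin_tac := repeat first
  [ exact: lin_id | exact: lin_contr2 | apply: lin_contr | apply: linD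
  | apply: linN | apply: linZ | apply: linMl | apply: linMr ].

Lemma conjc_i (R : realType) : conjc ('i : R[i]) = - 'i.
Proof. by apply/eqP; rewrite eq_complex /= oppr0 !eqxx. Qed.

Section Complexification.
Variables (R : realType) (m : nat).
Implicit Types (u v : 'rV[R]_m).

Lemma cmxM p q r (A : 'M[R]_(p, q)) (B : 'M[R]_(q, r)) :
  cmx (A *m B) = cmx A *m cmx B.
Proof. exact: map_mxM. Qed.
Lemma cmxD p q (A B : 'M[R]_(p, q)) : cmx (A + B) = cmx A + cmx B.
Proof. exact: map_mxD. Qed.
Lemma cmxB p q (A B : 'M[R]_(p, q)) : cmx (A - B) = cmx A - cmx B.
Proof. exact: map_mxB. Qed.
Lemma cmxN p q (A : 'M[R]_(p, q)) : cmx (- A) = - cmx A.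
Proof. exact: map_mxN. Qed.
Lemma cmxZ p q a (A : 'M[R]_(p, q)) : cmx (a *: A) = a%:C *: cmx A.
Proof. exact: map_mxZ. Qed.
Lemma cmx_tr p q (A : 'M[R]_(p, q)) : cmx A^T = (cmx A)^T.
Proof. by apply/matrixP => i j; rewrite !mxE. Qed.
Lemma cmx_row p q (A : 'M[R]_(p, q)) i : cmx (row i A) = row i (cmx A).
Proof. by apply/matrixP => k j; rewrite !mxE. Qed.
Lemma cmx_inj p q : injective (@cmx R p q).
Proof.
move=> A B /matrixP AB; apply/matrixP => i j.
by have := AB i j; rewrite !mxE => -[].
Qed.
Lemma cmx1 : cmx (1%:M : 'M[R]_m) = 1%:M.
Proof. exact: map_mx1. Qed.

Lemma bar_cmx p q (A : 'M[R]_(p, q)) : map_mx (@conjc R) (cmx A) = cmx A.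
Proof. by apply/matrixP => i j; rewrite !mxE conjc_real. Qed.

Lemma contr_cmx p q (M : 'I_m -> 'M[R]_(p, q)) u :
  contr (fun k => cmx (M k)) (cmx u) = cmx (contr M u).
Proof.
rewrite /contr [RHS](big_morph (@cmx R p q) (id1 := 0) (op1 := +%R)).
- by apply: eq_bigr => k _; rewrite cmxZ mxE.
- exact: cmxD.
- exact: map_mx0.
Qed.

Lemma contr_bar p q (M : 'I_m -> 'M[R]_(p, q)) (X : 'rV[R[i]]_m) :
  contr (fun k => cmx (M k)) (map_mx (@conjc R) X)
  = map_mx (@conjc R) (contr (fun k => cmx (M k)) X).
Proof.
rewrite /contr [RHS](big_morph (map_mx (@conjc R)) (id1 := 0) (op1 := +%R)).
- by apply: eq_bigr => k _; rewrite map_mxZ bar_cmx mxE.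
- by move=> A B; rewrite map_mxD.
- exact: map_mx0.
Qed.

Definition contr2 (Q : 'I_m -> 'I_m -> 'M[R]_m) (X Y : 'rV[R[i]]_m) :
  'M[R[i]]_m :=
  contr (fun i => contr (fun j => cmx (Q i j)) Y) X.

Lemma torsionCE (Gam : christoffel R m) x (X Y : 'rV[R[i]]_m) :
  torsionC Gam x X Y = Y *m contr (fun k => cmx (tmat Gam x k)) X.
Proof.
rewrite row_contr; apply: eq_bigr => i _; apply: eq_bigr => j _.
by rewrite torsionE /coord_field contr_delta -rowE cmx_row.
Qed.

Lemma curvatureCE (Gam : christoffel R m) x (X Y Z : 'rV[R[i]]_m) :
  (forall l v : 'I_m, derivable (fun y => cmat Gam y l) x (evec R v)) ->
  curvatureC Gam x X Y Z = Z *m contr2 (rmat Gam x) X Y.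
Proof.
move=> dC; rewrite /contr2 {1}/contr mulmx_sumr; apply: eq_bigr => i _.
rewrite -scalemxAr row_contr scaler_sumr; apply: eq_bigr => j _.
rewrite scaler_sumr; apply: eq_bigr => k _.
by rewrite curvatureE // cmx_row scalerA mulrA.
Qed.

Lemma mxform_cmx (G : 'M[R]_m) u v :
  mxform (cmx G) (cmx u) (cmx v) = (mxform G u v)%:C.
Proof. by rewrite /mxform -cmx_tr -!cmxM mxE. Qed.

(** For [X = A + i B] the value is the real number [G(A, A) + G(B, B)]. *)
Lemma mxform_bar_neq0 (G : 'M[R]_m) : G^T = G ->
  (forall u, u != 0 -> 0 < mxform G u u) ->
  forall X : 'rV[R[i]]_m, X != 0 -> mxform (cmx G) X (map_mx (@conjc R) X) != 0.
Proof.
move=> Gs Gpos X X0.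
pose A : 'rV[R]_m := map_mx (@complex.Re R) X.
pose B : 'rV[R]_m := map_mx (@complex.Im R) X.
have XE : X = cmx A + 'i *: cmx B.
  by apply/matrixP => i j; rewrite !mxE -complexE.
have bXE : map_mx (@conjc R) X = cmx A - 'i *: cmx B.
  rewrite {1}XE map_mxD map_mxZ !bar_cmx -scaleNr; congr (_ + _ *: _).
  exact: conjc_i.
rewrite bXE XE !(mxformDl, mxformBr, mxformZl, mxformZr).
rewrite !mxform_cmx (mxform_sym Gs B A).
set a := mxform G A A; set b := mxform G B B.
have -> : a%:C - 'i * (mxform G A B)%:C
    + ('i * (mxform G A B)%:C - 'i * ('i * b%:C)) = (a + b)%:C :> R[i].
  by rewrite rmorphD /= mulrA -expr2 sqr_i; ring.
have ge0 u : 0 <= mxform G u u.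
  by have [->|/Gpos/ltW //] := eqVneq u 0; rewrite mxform0l.
suff : a + b != 0 by apply: contra => /eqP[->].
apply/negP; rewrite paddr_eq0 ?ge0 // => /andP[a0 b0].
have A0 : A = 0.
  by apply/eqP; apply: contraLR a0 => /Gpos; rewrite lt0r => /andP[].
have B0 : B = 0.
  by apply/eqP; apply: contraLR b0 => /Gpos; rewrite lt0r => /andP[].
by move: X0; rewrite XE A0 B0 /cmx !map_mx0 scaler0 addr0 eqxx.
Qed.

End Complexification.

(** * The torsion tensor at a point in real coordinates *)

(* [C], [T] and [S] are the matrices of the Bismut connection, of its torsion
   and of its curvature, and [S'] those of the Chern curvature. *)
Section RealTorsion.
Variables (R : realType) (m : nat).
Local Notation M := 'M[R]_m.+1.
Local Notation CC := R[i].
Local Notation E := 'rV[CC]_m.+1.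
Variables (J G : M) (C T : 'I_m.+1 -> M) (S S' : 'I_m.+1 -> 'I_m.+1 -> M).
Variable c : R.
Local Notation A k := (Jpart J (T k)).

Hypothesis J2 : J *m J = - 1%:M.
Hypothesis Gsym : G^T = G.
Hypothesis Gpos : forall u, u != 0 -> 0 < mxform G u u.
Hypothesis GJ : J *m G *m J^T = G.
Hypothesis T_row : forall i j, row j (T i) = row j (C i) - row i (C j).
Hypothesis CJ : forall k, C k *m J = J *m C k.
Hypothesis TG : forall k, T k *m G = - (G *m (T k)^T).
Hypothesis S_anti : forall i j, S i j = - S j i.
Hypothesis SJ : forall i j, S i j *m J = J *m S i j.
Hypothesis SG : forall i j, S i j *m G + G *m (S i j)^T = 0.
Hypothesis S_bianchi : forall i j k,
  row k (S i j) + row i (S j k) + row j (S k i) =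
  row k (contr T (row j (T i))) + row i (contr T (row k (T j)))
    + row j (contr T (row i (T k))).
Hypothesis S_der : forall i j k,
  contr T (row k (S i j)) = T k *m S i j - S i j *m T k.
Hypothesis S'E : forall i j,
  S' i j = S i j - contr (fun k => A k) (row j (T i)) + A j *m A i - A i *m A j.
Hypothesis S'_sec : forall X : E, X *m cmx J = 'i *: X ->
  mxform (cmx G) (X *m contr2 S' X (bar X)) (bar X)
  = c%:C * mxform (cmx G) X (bar X) ^+ 2.
Hypothesis c0 : c != 0.

Let ad : {linear E -> 'M[CC]_m.+1} := contr (fun k => cmx (T k)).

Let ad_delta k : ad (delta_mx 0 k) = cmx (T k).
Proof. by rewrite /ad /= contr_delta. Qed.

Let ad_cmx u : ad (cmx u) = cmx (contr T u).
Proof. exact: contr_cmx. Qed.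

Let contr2_delta (Q : 'I_m.+1 -> 'I_m.+1 -> M) i j :
  contr2 Q (delta_mx 0 i) (delta_mx 0 j) = cmx (Q i j).
Proof. by rewrite /contr2 !contr_delta. Qed.

Let i2 : ('i : CC) * 'i = -1.
Proof. by rewrite -expr2 sqr_i. Qed.

Let cJ2 : cmx J *m cmx J = - 1%:M.
Proof. by rewrite -cmxM J2 cmxN cmx1. Qed.

Let br_anti (X Y : E) : Y *m ad X = - (X *m ad Y).
Proof.
move: Y; apply: (lin_ext (f := fun Y => Y *m ad X));
  [by lin_tac|by lin_tac|move=> j].
move: X; apply: (lin_ext (f := fun X => _ *m ad X));
  [by lin_tac|by lin_tac|move=> i].
by rewrite !ad_delta -!rowE -!cmx_row !T_row -cmxN opprB.
Qed.

Let form_skew (Q : E -> 'M[CC]_m.+1) (X Y Z : E) :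
  Q X *m cmx G + cmx G *m (Q X)^T = 0 ->
  mxform (cmx G) (Y *m Q X) Z = - mxform (cmx G) Y (Z *m Q X).
Proof.
move=> E0; rewrite mxformMl mxformMr; apply/eqP; rewrite -addr_eq0; apply/eqP.
have := congr1 (fun K => (Y *m K *m Z^T) 0 0) E0.
by rewrite mulmx0 mul0mx mulmxDr mulmxDl !mxE.
Qed.

Let adG (X : E) : ad X *m cmx G + cmx G *m (ad X)^T = 0.
Proof.
move: X; apply: (lin_ext (f := fun X => _ + _) (h := fun _ => 0)).
- apply: linD; first by lin_tac.
  by apply: linMl => a X Y; rewrite !linearP.
- by move=> a X Y; rewrite scaler0 addr0.
- by move=> k; rewrite ad_delta -cmx_tr -!cmxM -cmxD TG addNr /cmx map_mx0.
Qed.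

Let contr2G (Q : 'I_m.+1 -> 'I_m.+1 -> M) :
  (forall i j, Q i j *m G + G *m (Q i j)^T = 0) ->
  forall X Y : E, contr2 Q X Y *m cmx G + cmx G *m (contr2 Q X Y)^T = 0.
Proof.
move=> QG X Y; rewrite /contr2.
move: X; apply: (lin_ext (f := fun X => _ + _) (h := fun _ => 0)).
- apply: linD; first by lin_tac.
  by apply: linMl => a X X'; rewrite !linearP.
- by move=> a X X'; rewrite scaler0 addr0.
move=> i; rewrite contr_delta.
move: Y; apply: (lin_ext (f := fun X => _ + _) (h := fun _ => 0)).
- apply: linD; first by lin_tac.
  by apply: linMl => a X X'; rewrite !linearP.
- by move=> a X X'; rewrite scaler0 addr0.
- by move=> k; rewrite contr_delta -cmx_tr -!cmxM -cmxD QG /cmx map_mx0.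
Qed.

Let Gam : {linear E -> 'M[CC]_m.+1} := contr (fun k => cmx (C k)).

Let br_split (X Y : E) : Y *m ad X = Y *m Gam X - X *m Gam Y.
Proof.
move: Y; apply: (lin_ext (f := fun Y => Y *m ad X));
  [by lin_tac|by lin_tac|move=> j].
move: X; apply: (lin_ext (f := fun X => _ *m ad X));
  [by lin_tac|by lin_tac|move=> i].
by rewrite ad_delta /Gam /= !contr_delta -!rowE -!cmx_row T_row cmxB.
Qed.

Let GamJ X : Gam X *m cmx J = cmx J *m Gam X.
Proof.
move: X; apply: (lin_ext (f := fun X => Gam X *m _));
  [by lin_tac|by lin_tac|move=> i].
by rewrite /Gam /= contr_delta -!cmxM CJ.
Qed.

Let S_antiC X Y : contr2 S X Y = - contr2 S Y X.
Proof.
move: Y; apply: (lin_ext (f := contr2 S X)); [exact: lin_contr2| |move=> j].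
  by apply: linN; rewrite /contr2; lin_tac.
move: X; apply: (lin_ext (f := (contr2 S)^~ _));
  [by rewrite /contr2; lin_tac| |move=> i].
  by apply: linN; exact: lin_contr2.
by rewrite !contr2_delta S_anti cmxN.
Qed.

Let SJC X Y : contr2 S X Y *m cmx J = cmx J *m contr2 S X Y.
Proof.
rewrite /contr2; move: X; apply: (lin_ext (f := fun X => contr _ X *m _));
  [by lin_tac|by lin_tac|move=> i].
rewrite !contr_delta.
move: Y; apply: (lin_ext (f := fun X => contr _ X *m _));
  [by lin_tac|by lin_tac|move=> j].
by rewrite !contr_delta -!cmxM SJ.
Qed.

Let bianchiC X Y Z :
  Z *m contr2 S X Y + X *m contr2 S Y Z + Y *m contr2 S Z X =
  Z *m ad (Y *m ad X) + X *m ad (Z *m ad Y) + Y *m ad (X *m ad Z).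
Proof.
rewrite /contr2.
move: X; apply: (lin_ext (f := fun X => _ + _ + _));
  [by lin_tac|by lin_tac|move=> i].
move: Y; apply: (lin_ext (f := fun X => _ + _ + _));
  [by lin_tac|by lin_tac|move=> j].
move: Z; apply: (lin_ext (f := fun X => _ + _ + _));
  [by lin_tac|by lin_tac|move=> k].
rewrite -!/(contr2 S _ _) !contr2_delta !ad_delta -!rowE -!cmx_row !ad_cmx
  -!cmx_row.
by rewrite -!cmxD S_bianchi.
Qed.

Let derC X Y Z :
  ad (Z *m contr2 S X Y) = ad Z *m contr2 S X Y - contr2 S X Y *m ad Z.
Proof.
rewrite /contr2.
move: X; apply: (lin_ext (f := fun X => ad _));
  [by lin_tac|by lin_tac|move=> i].
move: Y; apply: (lin_ext (f := fun X => ad _));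
  [by lin_tac|by lin_tac|move=> j].
move: Z; apply: (lin_ext (f := fun X => ad _));
  [by lin_tac|by lin_tac|move=> k].
rewrite -!/(contr2 S _ _) !contr2_delta !ad_delta -!rowE -!cmx_row !ad_cmx.
by rewrite -!cmxM -cmxB S_der.
Qed.

Let JpartE X : Jpart (cmx J) (ad X) = contr (fun k => cmx (A k)) X.
Proof.
rewrite /Jpart; move: X.
apply: (lin_ext (f := fun X => _ *: (_ - _))); [by lin_tac|by lin_tac|move=> k].
rewrite contr_delta ad_delta -!cmxM -cmxB cmxZ; congr (_ *: _).
by rewrite fmorphV /= rmorph_nat.
Qed.

Section ChernReal.
Variables C' T' : 'I_m.+1 -> M.
Hypothesis T'_row : forall i j, row j (T' i) = row j (C' i) - row i (C' j).
Hypothesis C'J : forall k, C' k *m J = J *m C' k.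
Hypothesis CG : forall k, (C k - C' k) *m G + G *m (C k - C' k)^T = 0.
Hypothesis T'_mixed : forall X Y : E, X *m cmx J = 'i *: X ->
  Y *m cmx J = 'i *: Y ->
  bar Y *m contr (fun k => cmx (T' k)) X = 0.

Let B : {linear E -> 'M[CC]_m.+1} := contr (fun k => cmx (C k - C' k)).

Let B_split (X Y : E) :
  Y *m ad X - Y *m contr (fun k => cmx (T' k)) X = Y *m B X - X *m B Y.
Proof.
rewrite /B /=; move: Y; apply: (lin_ext (f := fun Y => _ - _));
  [by lin_tac|by lin_tac|move=> j].
move: X; apply: (lin_ext (f := fun X => _ - _));
  [by lin_tac|by lin_tac|move=> i].
rewrite ad_delta !contr_delta -!rowE -!cmx_row T_row T'_row -!cmxB.
by congr cmx; apply/rowP => l; rewrite !mxE; ring.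
Qed.

(** [chern_difference] for the complexified tensors, read back on the real
    coordinate vectors. *)
Lemma chern_coefficients k : C' k = C k - A k.
Proof.
suff BA X : B X = Jpart (cmx J) (ad X).
  suff <- : C k - C' k = A k by rewrite opprB addrCA subrr addr0.
  apply: cmx_inj.
  by have := BA (delta_mx 0 k); rewrite JpartE /B /= !contr_delta.
have Gu : cmx G \in unitmx.
  apply: (mxform_unit (conj := @conjc R)); exact: mxform_bar_neq0.
move: X; apply: (@chern_difference CC m (cmx J) (cmx G) ad B cJ2 Gu _
  br_anti _ _ _ 'i i2).
- by rewrite -cmx_tr -!cmxM GJ.
- by move=> X' Y' Z'; apply: (form_skew (Q := ad)); exact: adG.
- move=> X; rewrite /B /=; move: X.
  apply: (lin_ext (f := fun X => contr _ X *m _));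
    [by lin_tac|by lin_tac|move=> i].
  by rewrite contr_delta -!cmxM mulmxBl mulmxBr CJ C'J.
- move=> X Z W; apply: (form_skew (Q := B)); rewrite /B /=; move: X.
  apply: (lin_ext (f := fun X => _ + _) (h := fun _ => 0)).
  + apply: linD; first by lin_tac.
    by apply: linMl => a X' Y'; rewrite !linearP.
  + by move=> a X' Y'; rewrite scaler0 addr0.
  + by move=> l; rewrite contr_delta -cmx_tr -!cmxM -cmxD CG /cmx map_mx0.
move=> X Y hX hY; rewrite -B_split.
have hY' : bar Y *m cmx J = 'i *: bar Y.
  exact: (bar_ahol (conj := @conjc R) (conjc_i R) (bar_cmx J) hY).
have -> : Y = bar (bar Y) by apply/matrixP => a b; rewrite !mxE conjcK.
by rewrite T'_mixed // subr0.
Qed.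
End ChernReal.

Let S'EC X Y : contr2 S' X Y = contr2 S X Y - Jpart (cmx J) (ad (Y *m ad X))
  + Jpart (cmx J) (ad Y) *m Jpart (cmx J) (ad X)
  - Jpart (cmx J) (ad X) *m Jpart (cmx J) (ad Y).
Proof.
rewrite !JpartE /contr2.
move: X; apply: (lin_ext (f := fun X => contr _ X));
  [by lin_tac|by lin_tac|move=> i].
move: Y; apply: (lin_ext (f := fun Y => contr _ _));
  [by lin_tac|by lin_tac|move=> j].
rewrite -!/(contr2 _ _ _) !contr2_delta !contr_delta ad_delta -rowE -cmx_row
  contr_cmx.
by rewrite -!cmxM -cmxB -cmxD -cmxB S'E.
Qed.

Lemma torsion_tensor_eq0 k : T k = 0.
Proof.
suff T0 (X Y : E) : Y *m ad X = 0.
  apply: cmx_inj; rewrite -ad_delta; apply: row_ext => Y.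
  by rewrite T0 /cmx map_mx0 mulmx0.
apply: (@torsion_eq0 CC (@conjc R) m 'i c%:C (cmx J) (cmx G) ad
  (contr2 S) (contr2 S')).
- exact: conjcK.
- exact: conjc_i.
- exact: i2.
- exact: cJ2.
- by rewrite -cmx_tr Gsym.
- by rewrite -cmx_tr -!cmxM GJ.
- exact: mxform_bar_neq0.
- exact: bar_cmx.
- by move=> X' Y'; rewrite [ad _]contr_bar map_mxM.
- exact: br_anti.
- by move=> X' Y' Z'; apply: (form_skew (Q := ad)); exact: adG.
- move=> X' Y' hX hY; rewrite br_split -mulNmx.
  by apply: holD; [|rewrite mulNmx -scaleN1r; apply: holZ]; apply: hol_mul.
- by move=> X' X'' Y'; rewrite /contr2 linearD.
- by move=> X' Y' Y''; rewrite -[Y']scale1r /contr2 (lin_contr2 _ X') !scale1r.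
- exact: S_antiC.
- exact: SJC.
- by move=> X' Y' Z' W'; apply: (form_skew (Q := contr2 S X')); exact: contr2G.
- exact: bianchiC.
- exact: derC.
- by move=> a X' X'' Y'; rewrite /contr2 linearP.
- by move=> a X' Y' Y''; rewrite /contr2 (lin_contr2 _ X').
- exact: S'EC.
- exact: S'_sec.
- by rewrite (fmorph_eq0 (real_complex R)).
Qed.

End RealTorsion.

(** * Hermitian metrics and connections in a chart *)

Lemma stdJ2 (R : realType) n : stdJ R n *m stdJ R n = - 1%:M.
Proof.
rewrite /stdJ mulmx_block !(mulmx0, mul0mx, mul1mx, mulmx1, add0r, addr0).
by rewrite scalar_mx_block opp_block_mx !oppr0.
Qed.

Lemma mxform_delta (F : comNzRingType) m (G : 'M[F]_m) i j :
  mxform G (delta_mx 0 i) (delta_mx 0 j) = G i j.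
Proof. by rewrite /mxform -rowE trmx_delta -colE !mxE. Qed.

Section JpartCalculus.
Variables (R : realType) (m : nat) (J : 'M[R]_m).

Lemma is_derive_Jpart (V : normedModType R) (x v : V) (f : V -> 'M[R]_m) df :
  is_derive x v f df -> is_derive x v (fun y => Jpart J (f y)) (Jpart J df).
Proof.
move=> fd.
have dJ : is_derive x v (fun _ : V => J) 0 by exact: is_derive_cst.
have dh : is_derive x v (fun _ : V => 2^-1 : R) 0 by exact: is_derive_cst.
have d1 := is_derive_mulmx (is_derive_mulmx dJ fd) dJ.
have d2 := is_derive_scale dh (is_deriveB fd d1).
apply: (is_derive_eq d2).
by rewrite mul0mx add0r mulmx0 addr0 scale0r add0r.
Qed.

Lemma JpartMl (A B : 'M[R]_m) :
  A *m J = J *m A -> Jpart J (A *m B) = A *m Jpart J B.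
Proof. by move=> AJ; rewrite /Jpart -scalemxAr mulmxBr !mulmxA AJ. Qed.

Lemma JpartMr (A B : 'M[R]_m) :
  A *m J = J *m A -> Jpart J (B *m A) = Jpart J B *m A.
Proof. by move=> AJ; rewrite /Jpart -scalemxAl mulmxBl -!mulmxA AJ. Qed.

Lemma JpartN (A : 'M[R]_m) : Jpart J (- A) = - Jpart J A.
Proof. by rewrite /Jpart mulmxN mulNmx -opprD scalerN. Qed.

Lemma Jpart_contr (M : 'I_m -> 'M[R]_m) u :
  Jpart J (contr M u) = contr (fun k => Jpart J (M k)) u.
Proof.
rewrite /contr (big_morph (Jpart J) (id1 := 0) (op1 := +%R)).
- apply: eq_bigr => k _.
  by rewrite /Jpart -scalemxAr -scalemxAl -scalerBr !scalerA mulrC.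
- exact: JpartD.
- by rewrite /Jpart mulmx0 mul0mx subr0 scaler0.
Qed.

End JpartCalculus.

Section HermitianChart.
Variables (R : realType) (n : nat) (M : complexManifold R n).
Variables (g : hermitianMetric M) (a : chart R M (n + n)) (aA : atlas a).
Local Notation U := (chart_im a).
Local Notation G := (metric g a).
Local Notation J := (stdJ R n).
Local Notation e := (evec R).

Let oU : open U. Proof. exact: chart_im_open. Qed.

Lemma coord_smooth i : smooth U (@coord_field R (n + n) i).
Proof. by move=> k; exact: Ck_cst. Qed.

Lemma metric_tr x : U x -> (G x)^T = G x.
Proof.
move=> Ux; apply/matrixP => i j; rewrite mxE -mxform_delta -[RHS]mxform_delta.
exact: Defs.metric_sym.
Qed.

Lemma metric_stdJ x : U x -> J *m G x *m J^T = G x.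
Proof.
move=> Ux; apply/eqP; rewrite -subr_eq0; apply/eqP/form0P => u v.
have := metric_J g aA Ux u v; rewrite /bilin trmx_mul => E.
rewrite mulmxBr mulmxBl mxE [X in _ + X]mxE.
by rewrite !mulmxA in E *; rewrite E subrr.
Qed.

Lemma metric_pos_pair x u : U x -> u != 0 -> 0 < mxform (G x) u u.
Proof. by move=> Ux; exact: metric_pos. Qed.

Lemma metric_C2 i j : Ck 2 U (fun y => G y i j).
Proof. by apply: (Ck_coord _ _ oU); exact: metric_smooth. Qed.

Section Connection.
Variable D : connection M.
Local Notation C := (fun k y => cmat (gam D a) y k).
Local Notation T := (fun k y => tmat (gam D a) y k).

Lemma gam_C k i j : Ck k U (fun y => gam D a y i j).
Proof. exact: gam_smooth. Qed.

Lemma cmat_derivable k i y : U y -> derivable (C k) y (e i).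
Proof.
move=> Uy; apply/derivable_mxP => b c.
have [_ /(_ i)[/(_ y Uy) d _]] := Ck_coord 0 c oU (gam_C 1 k b).
have -> : (fun y => cmat (gam D a) y k b c) = (fun y => gam D a y k b 0 c)
  => //.
by apply/funext => z; rewrite mxE.
Qed.

Lemma tmat_C2 k b c : Ck 2 U (fun y => T k y b c).
Proof.
have -> : (fun y => T k y b c) = (fun y => (gam D a y k b - gam D a y b k) 0 c).
  by apply/funext => z; rewrite mxE.
by apply: (Ck_coord 0 c oU); apply: CkB => //; exact: gam_C.
Qed.

Lemma tmat_derivable k i y : U y -> derivable (T k) y (e i).
Proof.
move=> Uy; apply/derivable_mxP => b c.
by have [_ /(_ i)[/(_ y Uy) d _]] := tmat_C2 k b c.
Qed.

Lemma metric_parallel_mx : metric_parallel g D -> forall k y, U y ->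
  is_derive y (e k) G (C k y *m G y + G y *m (C k y)^T).
Proof.
move=> mp k y Uy; apply: is_derive_mx => b c.
have [_ /(_ k)[/(_ y Uy) d _]] := metric_C2 b c.
apply: DeriveDef => //.
have := mp a aA _ _ _ (coord_smooth k) (coord_smooth b) (coord_smooth c) y Uy.
have -> : pairing G (coord_field b) (coord_field c) = fun z => G z b c.
  by apply/funext => z; exact: mxform_delta.
move=> ->; rewrite !nabla_coord /pairing /coord_field mxE; congr (_ + _).
  by rewrite -[RHS]mxform_delta -[RHS]mxformMl -rowE rowK.
by rewrite -[RHS]mxform_delta -[RHS]mxformMr -rowE rowK.
Qed.

Lemma J_parallel_mx : J_parallel D -> forall k y, U y ->
  C k y *m J = J *m C k y.
Proof.
move=> Jp k y Uy; apply/row_matrixP => b; rewrite !rowE.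
have := Jp a aA _ _ (coord_smooth k) (coord_smooth b) y Uy.
rewrite nabla_coord /nabla /coord_field derive_cst add0r chrisE contr_delta.
by rewrite !mulmxA -!rowE rowK => ->.
Qed.

Lemma torsion_skew_mx : torsion_skew g D -> forall k y, U y ->
  T k y *m G y = - (G y *m (T k y)^T).
Proof.
move=> ts k y Uy; apply/matrixP => b c.
have [_] := ts a aA _ _ _ (coord_smooth k) (coord_smooth b) (coord_smooth c)
  y Uy.
rewrite /pairing !torsionE /coord_field !contr_delta => E.
have -> : G y *m (T k y)^T = (T k y *m G y)^T by rewrite trmx_mul metric_tr.
rewrite [RHS]mxE [X in _ = - X]mxE.
rewrite -[LHS]mxform_delta -[X in _ = - X]mxform_delta.
by rewrite /mxform !mulmxA.
Qed.

Lemma torsion_parallel_mx : torsion_parallel D -> forall i k y, U y ->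
  is_derive y (e i) (T k)
    (contr (T^~ y) (row k (C i y)) + C i y *m T k y - T k y *m C i y).
Proof.
move=> tp i k y Uy.
have dTy l v : derivable (T l) y (e v) by exact: tmat_derivable.
apply: DeriveDef => //; apply/row_matrixP => l.
have := tp a aA _ _ _ (coord_smooth i) (coord_smooth k) (coord_smooth l) y Uy.
rewrite (nabla_torsionE _ _ _ dTy) => E.
apply/eqP; rewrite -subr_eq0 -raddfB; apply/eqP; rewrite -[RHS]E {E}.
congr row; mx_ring.
Qed.

(** The fundamental form [W] is parallel, so its coordinate derivatives are
    values of [W] on connection coefficients; without torsion these coefficients
    are symmetric and cancel in the cyclic sum. *)
Lemma kahler_form_closed x i j k : U x -> hermitian_connection g D ->
  (forall l, T l x = 0) ->
  'D_(e i) (kahler_form g a j k) x + 'D_(e j) (kahler_form g a k i) x +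
  'D_(e k) (kahler_form g a i j) x = 0.
Proof.
move=> Ux [mp Jp] T0.
pose W := J *m G x.
have W_tr : W^T = - W.
  rewrite /W trmx_mul metric_tr // -[in RHS](metric_stdJ Ux) !mulmxA stdJ2.
  by rewrite mulNmx mul1mx mulNmx opprK.
have W_skew u v : mxform W u v = - mxform W v u.
  transitivity ((u *m W *m v^T)^T 0 0); first by rewrite [RHS]mxE.
  by rewrite 2!trmx_mul trmxK W_tr mulNmx mulmxN mxE mulmxA.
have DW l b c : 'D_(e l) (kahler_form g a b c) x =
    mxform W (row b (C l x)) (delta_mx 0 c)
    - mxform W (row c (C l x)) (delta_mx 0 b).
  have dJ : is_derive x (e l) (fun _ : 'rV[R]_(n + n) => J) 0.
    exact: is_derive_cst.
  have dG := metric_parallel_mx mp l Ux.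
  have [_ E] := is_derive_coord b c (is_derive_mulmx dJ dG).
  have -> : kahler_form g a b c = fun y => (J *m G y) b c.
    apply/funext => y.
    by rewrite -[RHS]mxform_delta /kahler_form /bilin /mxform !mulmxA.
  rewrite E mul0mx add0r mulmxDr !mulmxA -J_parallel_mx // mxE.
  rewrite (W_skew (row c _)) opprK; congr (_ + _).
    by rewrite rowE mxformMl -/(mxform _ _ _) mxform_delta !mulmxA.
  by rewrite rowE mxformMr -/(mxform _ _ _) mxform_delta.
have C_sym b c : row c (C b x) = row b (C c x).
  by apply/eqP; rewrite -subr_eq0 -tmatE T0 row0.
by rewrite !DW (C_sym j i) (C_sym k i) (C_sym k j); ring.
Qed.

End Connection.

End HermitianChart.

(** The dimension is a successor so that the algebra applies, where the matrices
    form a nontrivial ring. *)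
Lemma bismut_torsion_eq0 (R : realType) n (M : complexManifold R n.+1)
    (g : hermitianMetric M) (D D' : connection M) (c : R)
    (a : chart R M (n.+1 + n.+1)) x k :
  is_bismut g D -> torsion_parallel D -> is_chern g D' -> c != 0 ->
  (forall a, atlas a -> forall x, chart_im a x ->
    forall X : 'rV[R[i]]_(n.+1 + n.+1), T10 X -> X != 0 ->
    hol_sec_curv g D' a x X = c%:C) ->
  atlas a -> chart_im a x -> tmat (gam D a) x k = 0.
Proof.
move=> [[mp Jp] ts] tp [[mp' Jp'] ch'] c0 sec aA Ux.
have oU : open (chart_im a) by exact: chart_im_open.
pose C l y := cmat (gam D a) y l.
have dC l v y : chart_im a y -> derivable (C l) y (evec R v).
  exact: cmat_derivable.
have dC' l v y : chart_im a y ->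
    derivable (fun z => cmat (gam D' a) z l) y (evec R v).
  exact: cmat_derivable.
have CJ := J_parallel_mx aA Jp; have CJ' := J_parallel_mx aA Jp'.
have dT := torsion_parallel_mx aA tp.
have dG := metric_parallel_mx aA mp; have dG' := metric_parallel_mx aA mp'.
have TG := torsion_skew_mx aA ts.
have T2 := tmat_C2 aA D.
pose A l y := Jpart (stdJ R n.+1) (tmat (gam D a) y l).
have C'E y l : chart_im a y -> cmat (gam D' a) y l = cmat (gam D a) y l - A l y.
  move=> Uy.
  apply: (@chern_coefficients R (n + n.+1) (stdJ R n.+1) (metric g a y)
    (cmat (gam D a) y) (tmat (gam D a) y) _ _ _ _ _ _ _
    (cmat (gam D' a) y) (tmat (gam D' a) y)).
  - exact: (stdJ2 R n.+1).
  - exact: (metric_tr g aA Uy).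
  - by move=> u; exact: (metric_pos_pair g aA Uy).
  - exact: (metric_stdJ g aA Uy).
  - by move=> i j; exact: tmatE.
  - by move=> i; exact: CJ.
  - by move=> i; exact: TG.
  - by move=> i j; exact: tmatE.
  - by move=> i; exact: CJ'.
  - move=> i; have [_ e1] := dG i y Uy; have [_ e2] := dG' i y Uy.
    have : cmat (gam D a) y i *m metric g a y
           + metric g a y *m (cmat (gam D a) y i)^T =
           cmat (gam D' a) y i *m metric g a y
           + metric g a y *m (cmat (gam D' a) y i)^T.
      by rewrite -e1 -e2.
    move/eqP; rewrite -subr_eq0 => /eqP <-.
    by rewrite raddfB /= mulmxBl mulmxBr opprD addrACA.
  - by move=> X Y hX hY; rewrite -torsionCE; exact: ch'.
(* The operations defining [A] from the torsion are parallel, and so is [A]. *)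
have dA i l y : chart_im a y -> is_derive y (evec R i) (A l)
   (contr (A^~ y) (row l (cmat (gam D a) y i)) + cmat (gam D a) y i *m A l y
     - A l y *m cmat (gam D a) y i).
  move=> Uy.
  apply: (is_derive_eq (is_derive_Jpart (stdJ R n.+1) (dT i l y Uy))).
  by rewrite !JpartD JpartN Jpart_contr JpartMl ?JpartMr //; exact: CJ.
apply: (@torsion_tensor_eq0 R (n + n.+1) (stdJ R n.+1) (metric g a x)
  (cmat (gam D a) x)
    (tmat (gam D a) x) (rmat (gam D a) x) (rmat (gam D' a) x) c).
- exact: (stdJ2 R n.+1).
- exact: (metric_tr g aA Ux).
- by move=> u; exact: (metric_pos_pair g aA Ux).
- exact: (metric_stdJ g aA Ux).
- by move=> i j; exact: tmatE.
- by move=> i; exact: CJ.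
- by move=> i; exact: TG.
- by move=> i j; exact: rmat_anti.
- by move=> i j; apply: (curv_commute oU dC i j Ux).
- by move=> i j; apply: (curv_metric oU dC i j Ux) => //; exact: metric_C2.
- move=> i j l; apply: (curv_bianchi oU dC dT _ i j l Ux).
  by move=> *; exact: tmatE.
- by move=> i j l; exact: (curv_torsion oU dC T2 dT i j l Ux).
- move=> i j; rewrite tmatE.
  have C'E' l y (Uy : chart_im a y) := C'E y l Uy.
  exact: (curv_sub_parallel oU dC dA i j Ux C'E').
- move=> X hX; have [->|X0] := eqVneq X 0.
    by rewrite mul0mx !mxform0l expr0n /= mulr0.
  have := sec a aA x Ux X hX X0; rewrite /hol_sec_curv curvatureCE.
    have den0 : mxform (cmx (metric g a x)) X (bar X) ^+ 2 != 0.
      rewrite expf_neq0 //; apply: mxform_bar_neq0 => //.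
        exact: metric_tr.
      by move=> u; exact: metric_pos_pair.
    by move=> E; exact: (canRL (divfK den0) E).
  by move=> l v; exact: dC'.
- exact: c0.
Qed.

Theorem corollary1p3 (R : realType) (n : nat) (hn : (2 <= n)%N)
    (M : complexManifold R n) (g : hermitianMetric M) :
  BTP g ->
  (exists c : R, c != 0 /\ chern_hol_sec_curv_const g c) ->
  is_kahler g.
Proof.
case: n hn M g => [//|n] _ M g [D Db Dp] [c [c0 [D' D'c sec]]] a aA x Ux i j k.
apply: (kahler_form_closed aA (D := D)) => //; first by case: Db.
by move=> l; exact: (bismut_torsion_eq0 _ Db Dp D'c c0 sec aA Ux).
Qed.
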